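(* Let $M$ be a compact manifold and let $X\in\mathfrak{X}^1(M)$. If $X$ has collinear $C^1$-centralizer and all the singularities of $X$ are hyperbolic, then $X$ has quasi-trivial $C^1$-centralizer.
   Context: $M$ is a smooth, compact, boundaryless manifold of dimension $d\ge 2$ with a fixed Riemannian metric. $\mathfrak{X}^1(M)$ is the space of $C^1$ vector fields on $M$; $X_t$ denotes the flow of $X$. The $C^1$-centralizer of $X$ is $\mathfrak{C}^1(X)=\{Y\in\mathfrak{X}^1(M): [X,Y]=0\}$, equivalently the set of $C^1$ vector fields $Y$ whose flow commutes with that of $X$ ($X_t\circ Y_s=Y_s\circ X_t$ for all $s,t\in\mathbb{R}$). $X$ has collinear $C^1$-centralizer if for every $Y\in\mathfrak{C}^1(X)$ and every $x\in M$ the span of $X(x),Y(x)$ in $T_xM$ has dimension at most $1$. $X$ has quasi-trivial $C^1$-centralizer if for every $Y\in\mathfrak{C}^1(X)$ there is a $C^1$ function $f\colon M\to\mathbb{R}$ with $X\cdot f\equiv 0$ and $Y(x)=f(x)X(x)$ for every $x\in M$. A singularity of $X$ is a point $\sigma$ with $X(\sigma)=0$; it is hyperbolic if $DX(\sigma)$ has no eigenvalue on the imaginary axis. *)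

(* Defs.v *)
From HB Require Import structures.
From mathcomp Require Import all_boot all_order all_algebra.
From mathcomp Require Import all_classical all_reals all_analysis.
From mathcomp Require Import complex.
Set Implicit Arguments.
Unset Strict Implicit.
Unset Printing Implicit Defensive.
Import Order.TTheory GRing.Theory Num.Theory.
Import numFieldNormedType.Exports.
Local Open Scope classical_set_scope.
Local Open Scope ring_scope.

(* Meant for open U. In finite dimension, continuity of u |-> 'd f u v for
   every fixed v is the usual continuity of the derivative. *)
Fixpoint Ck_on (R : realType) (V W : normedModType R) (k : nat)
    (U : set V) (f : V -> W) : Prop :=
  if k is k'.+1 then
    (forall u, U u -> differentiable f u) /\
    (forall v, Ck_on k' U (fun u => 'd f u v))
  else forall u, U u -> {for u, continuous f}.

Definition smooth_on (R : realType) (V W : normedModType R)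
    (U : set V) (f : V -> W) : Prop :=
  forall k, Ck_on k U f.

(* A homeomorphism between an open subset of M and an open subset of R^d.
   [to_coord] and [of_coord] are total; their values outside [dom] and [cod]
   are irrelevant. *)
Record chart (R : realType) (d : nat) (M : topologicalType) := Chart {
  dom : set M;
  cod : set 'rV[R]_d;
  to_coord : M -> 'rV[R]_d;
  of_coord : 'rV[R]_d -> M;
  open_dom : open dom;
  open_cod : open cod;
  to_coord_cod : forall x, dom x -> cod (to_coord x);
  of_coord_dom : forall u, cod u -> dom (of_coord u);
  to_coordK : forall x, dom x -> of_coord (to_coord x) = x;
  of_coordK : forall u, cod u -> to_coord (of_coord u) = u;
  to_coord_continuous : forall x, dom x -> {for x, continuous to_coord};
  of_coord_continuous : forall u, cod u -> {for u, continuous of_coord}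
}.

(* Boundaryless, since charts have open image in R^d. The function [chart_at]
   selects a chart around each point; it serves only to write tangent vectors
   in coordinates. *)
Record smooth_manifold (R : realType) (d : nat) := SmoothManifold {
  carrier :> topologicalType;
  chart_index : Type;
  atlas : chart_index -> chart R d carrier;
  chart_at : carrier -> chart_index;
  manifold_hausdorff : hausdorff_space carrier;
  manifold_second_countable : @second_countable carrier;
  chart_at_dom : forall x, dom (atlas (chart_at x)) x;
  transition_smooth : forall i j,
    smooth_on (cod (atlas i) `&` of_coord (atlas i) @^-1` dom (atlas j))
              (to_coord (atlas j) \o of_coord (atlas i))
}.

(* T_x M is identified with R^d by the differential at x of the chart
   [chart_at x]: the value at x of a vector field is recorded by its
   coordinates in that chart. No regularity of x |-> chart_at x is assumed, so
   regularity of a field must be read on its representatives [field_in]. *)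
Definition vector_field (R : realType) (d : nat) (M : smooth_manifold R d) :=
  M -> 'rV[R]_d.

Section Fields.
Context {R : realType} {d : nat} {M : smooth_manifold R d}.

Definition chart_near (x : M) : chart R d M := atlas (chart_at x).

Definition coord_at (x : M) : 'rV[R]_d := to_coord (chart_near x) x.

(* The pushforward of X by the chart i, a vector field on [cod (atlas i)]. In
   particular [field_in (chart_at x) X (coord_at x) = X x]. *)
Definition field_in (i : chart_index M) (X : vector_field M)
    (u : 'rV[R]_d) : 'rV[R]_d :=
  let y := of_coord (atlas i) u in
  'd (to_coord (atlas i) \o of_coord (chart_near y)) (coord_at y) (X y).

Definition C1_field (X : vector_field M) : Prop :=
  forall i, Ck_on 1 (cod (atlas i)) (field_in i X).

Definition C1_function (f : M -> R) : Prop :=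
  forall i, Ck_on 1 (cod (atlas i)) (f \o of_coord (atlas i)).

Definition lie_derivative (X : vector_field M) (f : M -> R) (x : M) : R :=
  'd (f \o of_coord (chart_near x)) (coord_at x) (X x).

Definition lie_bracket (X Y : vector_field M) : vector_field M := fun x =>
  'd (field_in (chart_at x) Y) (coord_at x) (X x)
  - 'd (field_in (chart_at x) X) (coord_at x) (Y x).

Definition C1_centralizer (X : vector_field M) : set (vector_field M) :=
  [set Y | C1_field Y /\ forall x, lie_bracket X Y x = 0].

Definition collinear_C1_centralizer (X : vector_field M) : Prop :=
  forall Y, C1_centralizer X Y ->
  forall x, (\dim <<[:: X x; Y x]>>%VS <= 1)%N.

Definition quasi_trivial_C1_centralizer (X : vector_field M) : Prop :=
  forall Y, C1_centralizer X Y ->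
  exists f : M -> R,
    [/\ C1_function f,
        forall x, lie_derivative X f x = 0 &
        forall x, Y x = f x *: X x].

Definition singularity (X : vector_field M) (s : M) : Prop := X s = 0.

(* At a singularity s, the matrix of the endomorphism DX(s) of T_s M. *)
Definition linear_part (X : vector_field M) (s : M) : 'M[R]_d :=
  'J (field_in (chart_at s) X) (coord_at s).

Definition hyperbolic (X : vector_field M) (s : M) : Prop :=
  forall z : R[i],
    eigenvalue (map_mx (real_complex R) (linear_part X s)) z ->
    complex.Re z != 0.

End Fields.

(* Main.v *)
Require Import Defs.
From HB Require Import structures.
From mathcomp Require Import all_boot all_order all_algebra.
From mathcomp Require Import all_classical all_reals all_analysis.
From mathcomp Require Import complex ring lra.
Set Implicit Arguments.
Unset Strict Implicit.
Unset Printing Implicit Defensive.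
Import Order.TTheory GRing.Theory Num.Theory.
Import numFieldNormedType.Exports.
Local Open Scope classical_set_scope.
Local Open Scope ring_scope.

(** Away from the singularities of [X], collinearity gives [Y = f X] with [f] of
    class C1, and [[X, Y] = 0] reads [(X.f) X = 0], so [f] is a first integral
    of [X] ([factor_C1_regular], [factor_invariant_regular]). The whole question
    is whether [f] extends as a C1 function through a singularity [s].

    Since [A = DX(s)] is invertible, [[X, Y](s) = 0] forces [Y(s) = 0], and
    passing to the limit in the collinearity relation along rays gives
    [DY(s) = c A] for a scalar [c]; hence [f] extends continuously by
    [f(s) = c] ([collinear_scalar], [factor_limit]). It remains to show that
    [grad f] tends to [0] at [s]; the mean value theorem then makes [f] of class
    C1 at [s] with derivative [0] ([hyperbolic_C1_extension]).

    A hyperbolic matrix has a quadratic form that increases strictly along its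
    flow ([hyperbolic_lyapunov]). If the form [L] obtained for [A] is definite,
    [s] is a sink or a source and [f], being continuous and constant along
    orbits, is constant near [s] ([definite_grad0]).

    At a saddle the gradient [p] of [f] satisfies the adjoint equation
    [p' = - DX^T p] along orbits. A Lyapunov form [- K] of this equation,
    slightly tilted as [N = - K + eta |.|^2], grows along orbits at a rate at
    least [c |p|^2]. The point is that [N(p)] cannot exceed [m] near [s] when it
    does not exceed [m > 0] on a sphere around [s]. Otherwise the set
    [Z = {s} U {N(p) > m}] would be forward invariant in the ball and have
    interior; but two points of [Z] cannot differ by a vector on which
    [L > 0], since [L] of the difference of two orbits grows strictly as long as
    both stay in the ball ([saddle_maximum_principle]). Applied to [N(p)], and then
    to [N(p)] minus a small multiple of the squared distance to [s], this shows
    that the supremum of [N(p)] over small balls decreases geometrically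
    ([grad_decay_step], [grad_limsup]). The same holds for [K + eta |.|^2] and
    [- X]; the sum of the two forms is [2 eta |p|^2], so [p] tends to [0]
    ([saddle_grad_cvg0]).

    No orbit is ever constructed: strict growth along orbits is used through the
    first-order condition at a maximum point. As [p] is merely continuous, it is
    replaced there by difference quotients of [f], which are differentiable,
    converge to [p] locally uniformly, and satisfy the adjoint equation in the
    limit ([diff_quot_along_cvg], [local_max_incr]). *)

(** * Bilinear forms on row vectors *)

Section Forms.
Context {R : realType} {d : nat}.
Implicit Types (x y z w : 'rV[R]_d) (S A : 'M[R]_d).

Definition bil S x y : R := (x *m S *m y^T) 0 0.

(** The Euclidean square norm, whereas [`|x|] is the sup norm. *)
Definition sqn x : R := bil 1%:M x x.

Lemma bilDl S x y z : bil S (x + y) z = bil S x z + bil S y z.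
Proof. by rewrite /bil !mulmxDl mxE. Qed.

Lemma bilDr S x y z : bil S x (y + z) = bil S x y + bil S x z.
Proof. by rewrite /bil linearD /= mulmxDr mxE. Qed.

Lemma bilZl S a x y : bil S (a *: x) y = a * bil S x y.
Proof. by rewrite /bil -!scalemxAl mxE. Qed.

Lemma bilZr S a x y : bil S x (a *: y) = a * bil S x y.
Proof. by rewrite /bil linearZ /= -!scalemxAr mxE. Qed.

Lemma bilNl S x y : bil S (- x) y = - bil S x y.
Proof. by rewrite -scaleN1r bilZl mulN1r. Qed.

Lemma bilNr S x y : bil S x (- y) = - bil S x y.
Proof. by rewrite -scaleN1r bilZr mulN1r. Qed.

Lemma bilBl S x y z : bil S (x - y) z = bil S x z - bil S y z.
Proof. by rewrite bilDl bilNl. Qed.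

Lemma bilBr S x y z : bil S x (y - z) = bil S x y - bil S x z.
Proof. by rewrite bilDr bilNr. Qed.

Lemma bil0l S y : bil S 0 y = 0.
Proof. by rewrite -(scale0r 0) bilZl mul0r. Qed.

Lemma bil0r S x : bil S x 0 = 0.
Proof. by rewrite -(scale0r 0) bilZr mul0r. Qed.

Lemma bilDm S S' x y : bil (S + S') x y = bil S x y + bil S' x y.
Proof. by rewrite /bil mulmxDr mulmxDl mxE. Qed.

Lemma bilZm a S x y : bil (a *: S) x y = a * bil S x y.
Proof. by rewrite /bil -scalemxAr -scalemxAl mxE. Qed.

Lemma bilNm S x y : bil (- S) x y = - bil S x y.
Proof. by rewrite -scaleN1r bilZm mulN1r. Qed.

Lemma bilC S x y : S^T = S -> bil S x y = bil S y x.
Proof.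
move=> hS; rewrite /bil -[in LHS](trmxK (x *m S *m y^T)) mxE.
by rewrite !trmx_mul trmxK hS mulmxA.
Qed.

Lemma bilE S x y : bil S x y = \sum_i \sum_j S i j * (x 0 i * y 0 j).
Proof.
rewrite /bil mxE exchange_big /=; apply: eq_bigr => j _.
by rewrite !mxE mulr_suml; apply: eq_bigr => i _; ring.
Qed.

Lemma bil_congr m (B : 'M[R]_(d, m)) (D : 'M[R]_m) x y :
  bil (B *m D *m B^T) x y = ((x *m B) *m D *m (y *m B)^T) 0 0.
Proof. by rewrite /bil trmx_mul !mulmxA. Qed.

Lemma bil_diag (g : 'I_d -> R) x y :
  bil (diag_mx (\row_j g j)) x y = \sum_j g j * (x 0 j * y 0 j).
Proof.
rewrite /bil mul_mx_diag mxE; apply: eq_bigr => j _.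
by rewrite !mxE; ring.
Qed.

Lemma dotE x y : bil 1%:M x y = \sum_i x 0 i * y 0 i.
Proof. by rewrite /bil mulmx1 mxE; apply: eq_bigr => i _; rewrite mxE. Qed.

Lemma sqnE x : sqn x = \sum_i x 0 i ^+ 2.
Proof. by rewrite /sqn dotE; apply: eq_bigr => i _; rewrite expr2. Qed.

Lemma sqn_ge0 x : 0 <= sqn x.
Proof. by rewrite sqnE sumr_ge0 // => i _; exact: sqr_ge0. Qed.

Lemma coord_norm_le x i : `|x 0 i| <= `|x|.
Proof.
rewrite [leRHS]/Num.Def.normr/= mx_normrE.
exact: (le_bigmax _ _ (0, i)).
Qed.

Lemma norm_le_coord x e : 0 <= e -> (forall i, `|x 0 i| <= e) -> `|x| <= e.
Proof.
move=> e0 h; rewrite [leLHS]/Num.Def.normr/= mx_normrE.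
by apply: bigmax_le => // -[i j] _ /=; rewrite (ord1 i).
Qed.

Lemma sqr_norm_le_sqn x : `|x| ^+ 2 <= sqn x.
Proof.
have e0 : 0 <= Num.sqrt (sqn x) by exact: sqrtr_ge0.
rewrite -(sqr_sqrtr (sqn_ge0 x)) ler_sqr ?nnegrE //.
apply: norm_le_coord => // i; rewrite -sqrtr_sqr ler_sqrt ?sqn_ge0 //.
by rewrite sqnE (bigD1 i) //= lerDl sumr_ge0 // => j _; exact: sqr_ge0.
Qed.

Lemma sqn_gt0 x : x != 0 -> 0 < sqn x.
Proof.
move=> x0; apply: lt_le_trans (sqr_norm_le_sqn x).
by rewrite exprn_gt0 // normr_gt0.
Qed.

(** A crude operator bound for the sup norm; only its finiteness, and the fact
    that it tends to [0] with the matrix, matter. *)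
Definition mxbound S : R := \sum_i \sum_j `|S i j|.

Lemma mxbound_ge0 S : 0 <= mxbound S.
Proof. by do 2![apply: sumr_ge0 => ? _]. Qed.

Lemma bil_le S x y : `|bil S x y| <= mxbound S * `|x| * `|y|.
Proof.
rewrite bilE /mxbound -mulrA mulr_suml; apply: le_trans (ler_norm_sum _ _ _) _.
apply: ler_sum => i _; rewrite mulr_suml.
apply: le_trans (ler_norm_sum _ _ _) _; apply: ler_sum => j _.
by rewrite normrM ler_wpM2l // normrM ler_pM // coord_norm_le.
Qed.

Lemma bil_le_sqn S x : `|bil S x x| <= mxbound S * sqn x.
Proof.
apply: le_trans (bil_le _ _ _) _; rewrite -mulrA -expr2.
by rewrite ler_wpM2l ?mxbound_ge0 ?sqr_norm_le_sqn.
Qed.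

Lemma normM_le S x : `|x *m S| <= mxbound S * `|x|.
Proof.
apply: norm_le_coord => [|j]; first by rewrite mulr_ge0 ?mxbound_ge0.
rewrite mxE; apply: le_trans (ler_norm_sum _ _ _) _.
rewrite /mxbound mulr_suml; apply: ler_sum => i _.
rewrite normrM mulrC ler_pM ?coord_norm_le //.
by rewrite (bigD1 j) //= lerDl sumr_ge0.
Qed.

End Forms.

(** * Lyapunov forms of hyperbolic matrices *)

Section Lyapunov.
Context {R : realType}.
Local Notation C := R[i].

Let csq (z : C) : R := complex.Re z ^+ 2 + complex.Im z ^+ 2.

Lemma finite_pos_lower_bound n (x : 'I_n -> R) :
  (forall j, 0 < x j) -> exists2 l, 0 < l & forall j, l <= x j.
Proof.
move=> x0; have s0 : 0 < 1 + \sum_j (x j)^-1.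
  by rewrite ltr_pwDl // sumr_ge0 // => j _; rewrite invr_ge0 ltW.
exists (1 + \sum_j (x j)^-1)^-1; first by rewrite invr_gt0.
move=> j; rewrite -[leRHS]invrK lef_pV2 ?posrE ?invr_gt0 //.
rewrite (bigD1 j) //= addrCA lerDl addr_ge0 // sumr_ge0 // => k _.
by rewrite invr_ge0 ltW.
Qed.

Lemma Re_sum (I : finType) (F : I -> C) :
  complex.Re (\sum_i F i) = \sum_i complex.Re (F i).
Proof. by elim/big_rec2: _ => [//|i x [a b] _ <-]; case: (F i). Qed.

Lemma Im_sum (I : finType) (F : I -> C) :
  complex.Im (\sum_i F i) = \sum_i complex.Im (F i).
Proof. by elim/big_rec2: _ => [//|i x [a b] _ <-]; case: (F i). Qed.

Let sgT n (T : 'M[C]_n) (j : 'I_n) : R := Num.sg (complex.Re (T j j)).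

(** Weights [g j = sgn (Re T_jj) K^(2 j)] work for [K] large. The diagonal
    contributes [|Re T_jj| K^(2 j) |z_j|^2]. An entry [T_ij] with [i > j] couples
    [z_j] to [z_i], whose weight is at least [K^2] times larger than that of
    [z_j], so by the inequality between means its contribution is [O(1/K)] times
    the diagonal one. *)
Lemma trig_lyapunov n (T : 'M[C]_n) :
  is_trig_mx T -> (forall j, complex.Re (T j j) != 0) ->
  exists g : 'I_n -> R, exists2 c : R, 0 < c & forall z : 'rV[C]_n,
    c * (\sum_j csq (z 0 j)) <=
    \sum_j g j * (complex.Re (z 0 j) * complex.Re ((z *m T) 0 j)
                  + complex.Im (z 0 j) * complex.Im ((z *m T) 0 j)).
Proof.
move=> /is_trig_mxP trigT T0.
have [l l0 lT] : exists2 l : R, 0 < l & forall j, l <= `|complex.Re (T j j)|.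
  by apply: finite_pos_lower_bound => j; rewrite normr_gt0.
pose m i j : R := `|complex.Re (T i j)| + `|complex.Im (T i j)|.
have m_ge0 i j : 0 <= m i j by rewrite addr_ge0.
pose M : R := 1 + \sum_i \sum_j m i j.
have mM i j : m i j <= M.
  rewrite /M (bigD1 i) //= (bigD1 j) //=.
  have : 0 <= \sum_(i0 < n | i0 != j) m i i0 by exact: sumr_ge0.
  have : 0 <= \sum_(i0 < n | i0 != i) \sum_(j < n) m i0 j.
    by apply: sumr_ge0 => *; exact: sumr_ge0.
  lra.
have M1 : 1 <= M by rewrite lerDl; do 2![apply: sumr_ge0 => ? _].
pose K : R := 1 + 2 * n%:R * M / l.
have nMl0 : 0 <= 2 * n%:R * M / l.
  have M0 : 0 <= M by lra.
  by apply: divr_ge0; [rewrite !mulr_ge0|exact: ltW].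
have K1 : 1 <= K by rewrite /K lerDl.
have K0 : 0 < K by exact: lt_le_trans K1.
exists (fun j : 'I_n => sgT T j * K ^+ (2 * j)); exists (l / 2); first by lra.
move=> z; pose a (j : 'I_n) : R := K ^+ (2 * j) * csq (z 0 j).
have csq_ge0 u : 0 <= csq u by rewrite addr_ge0 ?sqr_ge0.
have a_ge j : csq (z 0 j) <= a j by rewrite ler_peMl // exprn_ege1.
have a_ge0 j : 0 <= a j by exact: le_trans (a_ge j).
pose t : R := M / (2 * K).
pose F (j i : 'I_n) : R := sgT T j * K ^+ (2 * j) *
  (complex.Re (z 0 j) * complex.Re (z 0 i * T i j)
   + complex.Im (z 0 j) * complex.Im (z 0 i * T i j)).
have Fge j i : (i == j)%:R * (l * a j) - t * (a i + a j) <= F j i.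
  have t0 : 0 <= t * (a i + a j).
    by apply: mulr_ge0; [apply: divr_ge0; [|apply: mulr_ge0]|exact: addr_ge0]; lra.
  case: (ltngtP i j) => [ij|ji|/val_inj eij].
  - rewrite /F (trigT _ _ ij) mulr0 /= !mulr0 addr0 mulr0 -val_eqE /= ltn_eqF //.
    by rewrite mul0r add0r oppr_le0.
  - rewrite -val_eqE /= gtn_eqF // mul0r add0r /F.
    move: (mM i j); rewrite /t /a /m /csq.
    have : K ^+ (2 * j) * K ^+ 2 <= K ^+ (2 * i).
      by rewrite -exprD ler_weXn2l // -mulnSr leq_mul2l.
    have : 0 <= K ^+ (2 * j) by rewrite exprn_ge0 // ltW.
    have : `|sgT T j| <= 1 by rewrite normr_sg; case: eqP.
    case: (T i j) => t1 t2 /=; case: (z 0 i) => x1 x2; case: (z 0 j) => y1 y2 /=.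
    move: (K ^+ (2 * j)) (K ^+ (2 * i)) (sgT T j) => g h s sg g0 gh hm.
    set e := (X in _ <= s * g * X).
    suff he : `|e| <= M / (2 * K) * (K ^+ 2 * (x1 ^+ 2 + x2 ^+ 2)
                                     + (y1 ^+ 2 + y2 ^+ 2)).
      have h1 : `|s * g * e| <= g * `|e|.
        by rewrite !normrM (ger0_norm g0) ler_wpM2r // ler_piMl.
      rewrite lerNl; apply: le_trans (ler_norm _) _; rewrite normrN.
      apply: le_trans h1 _; apply: le_trans (ler_wpM2l g0 he) _.
      rewrite mulrCA ler_wpM2l //; first by apply: divr_ge0; [|apply: mulr_ge0]; lra.
      rewrite mulrDr lerD2r mulrA ler_wpM2r //.
      by rewrite addr_ge0 ?sqr_ge0.
    have -> : M / (2 * K) * (K ^+ 2 * (x1 ^+ 2 + x2 ^+ 2) + (y1 ^+ 2 + y2 ^+ 2))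
       = M / 2 * (K * (x1 ^+ 2 + x2 ^+ 2) + K^-1 * (y1 ^+ 2 + y2 ^+ 2)).
      by field; rewrite gt_eqF.
    pose k := Num.sqrt K.
    have k0 : 0 < k by rewrite sqrtr_gt0.
    have Kk : K = k ^+ 2 by rewrite sqr_sqrtr // ltW.
    rewrite Kk.
    have -> : k ^+ 2 * (x1 ^+ 2 + x2 ^+ 2) + (k ^+ 2)^-1 * (y1 ^+ 2 + y2 ^+ 2) =
       (k * x1) ^+ 2 + (k * x2) ^+ 2 + (k^-1 * y1) ^+ 2 + (k^-1 * y2) ^+ 2.
      by field; rewrite gt_eqF.
    have -> : e = t1 * ((k * x1) * (k^-1 * y1) + (k * x2) * (k^-1 * y2))
                + t2 * ((k * x1) * (k^-1 * y2) - (k * x2) * (k^-1 * y1)).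
      by rewrite /e; field; rewrite gt_eqF.
    move: (k * x1) (k * x2) (k^-1 * y1) (k^-1 * y2) => p q r o.
    set Z := p ^+ 2 + q ^+ 2 + r ^+ 2 + o ^+ 2.
    have b1 : `|p * r + q * o| <= Z / 2.
      by rewrite ler_norml /Z; apply/andP; split;
        [have := sqr_ge0 (p + r); have := sqr_ge0 (q + o)|
         have := sqr_ge0 (p - r); have := sqr_ge0 (q - o)]; lra.
    have b2 : `|p * o - q * r| <= Z / 2.
      by rewrite ler_norml /Z; apply/andP; split;
        [have := sqr_ge0 (p + o); have := sqr_ge0 (q - r)|
         have := sqr_ge0 (p - o); have := sqr_ge0 (q + r)]; lra.
    apply: le_trans (ler_normD _ _) _; rewrite !normrM.
    apply: (@le_trans _ _ (`|t1| * (Z / 2) + `|t2| * (Z / 2))).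
      by rewrite lerD // ler_wpM2l.
    rewrite -mulrDl -mulrA (mulrC 2^-1) ler_wpM2r //.
    by rewrite divr_ge0 // /Z !addr_ge0 // sqr_ge0.
  - subst i; rewrite eqxx mul1r.
    have -> : F j j = `|complex.Re (T j j)| * a j.
      rewrite /F /sgT /a /csq normrEsg; case: (T j j) => t1 t2.
      by case: (z 0 j) => x1 x2 /=; ring.
    apply: (@le_trans _ _ (l * a j)); last by rewrite ler_wpM2r.
    by rewrite lerBlDr lerDl.
have -> : \sum_j sgT T j * K ^+ (2 * j) *
     (complex.Re (z 0 j) * complex.Re ((z *m T) 0 j)
      + complex.Im (z 0 j) * complex.Im ((z *m T) 0 j)) = \sum_j \sum_i F j i.
  apply: eq_bigr => j _; rewrite /F -mulr_sumr mxE Re_sum Im_sum.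
  by congr (_ * _); rewrite big_split /= -!mulr_sumr.
apply: (@le_trans _ _ (\sum_j \sum_i ((i == j)%:R * (l * a j) - t * (a i + a j)))); last first.
  by apply: ler_sum => j _; apply: ler_sum => i _.
have -> : \sum_j \sum_i ((i == j)%:R * (l * a j) - t * (a i + a j))
   = (l - 2 * n%:R * t) * \sum_j a j.
  under eq_bigr => j _.
    rewrite sumrB (bigD1 j) //= eqxx mul1r big1 ?addr0 => [|i /negPf->];
      last by rewrite mul0r.
    rewrite -mulr_sumr big_split /= sumr_const card_ord.
    over.
  rewrite sumrB -!mulr_sumr big_split /= sumr_const card_ord sumrMnl.
  by rewrite -[(\sum_i a i) *+ n]mulr_natl; ring.
have nt : 2 * n%:R * t <= l / 2.
  have -> : 2 * n%:R * t = (2 * n%:R * M / l) * (l / 2) / K.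
    by rewrite /t; field; rewrite !gt_eqF.
  by rewrite ler_pdivrMr // mulrC ler_wpM2l // /K; lra.
apply: le_trans (_ : l / 2 * \sum_j a j <= _).
  by apply: ler_wpM2l; [lra|apply: ler_sum => j _; exact: a_ge].
by rewrite ler_wpM2r ?sumr_ge0 //; lra.
Qed.


Definition hyperbolic_mx n (A : 'M[R]_n) := forall z : C,
  eigenvalue (map_mx (real_complex R) A) z -> complex.Re z != 0.

(** A matrix and its transpose have the same characteristic polynomial. The
    transpose drives the adjoint equation satisfied by gradients. *)
Lemma hyperbolic_mxT n (A : 'M[R]_n) : hyperbolic_mx A -> hyperbolic_mx A^T.
Proof.
move=> hA z; rewrite eigenvalue_root_char => rz; apply: hA.
rewrite eigenvalue_root_char; congr (is_true (root _ z)): rz.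
by rewrite /char_poly -det_tr /char_poly_mx linearB /= tr_scalar_mx !map_trmx trmxK.
Qed.

Lemma hyperbolic_unitmx n (A : 'M[R]_n) : hyperbolic_mx A -> A \in unitmx.
Proof.
move=> hA; rewrite unitmxE unitfE; apply/eqP => detA0.
suff /hA : eigenvalue (map_mx (real_complex R) A) 0 by rewrite /= eqxx.
rewrite eigenvalue_root_char /root horner_coef0 char_poly_det det_map_mx detA0.
by rewrite rmorph0 mulr0.
Qed.

(** Schur triangularisation over [R[i]] reduces the statement to
    [trig_lyapunov]. For real [w] the Hermitian form found there is a form in the
    real and imaginary parts of the complex coordinates [w Q], hence a real
    symmetric form in [w]; the unitarity of [Q] turns the lower bound into the
    Euclidean square norm of [w]. *)
Theorem hyperbolic_lyapunov n (A : 'M[R]_n) : hyperbolic_mx A ->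
  exists S : 'M[R]_n, exists2 c : R, S^T = S /\ 0 < c &
    forall w, c * sqn w <= bil S w (w *m A).
Proof.
case: n A => [|n] A hA.
  exists 0; exists 1 => [|w]; first by rewrite trmx0 ltr01.
  by rewrite /bil /sqn !bilE !big_ord0 mulr0 /bil mulmx0 mul0mx mxE.
pose Ac := map_mx (real_complex R) A.
have [T [P [Q [trigT PQ QP defT Qu]]]] : exists T P Q : 'M[C]_n.+1,
    [/\ is_trig_mx T, P *m Q = 1%:M, Q *m P = 1%:M, T = P *m Ac *m Q &
        Q \is unitarymx].
  have [P Pu trigT] := Schur Ac (ltn0Sn n).
  have PQ : P *m (map_mx Num.conj P^T) = 1%:M by exact/unitarymxP.
  exists (conjmx P Ac), P, (map_mx Num.conj P^T); split.
  - exact: trigT.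
  - exact: PQ.
  - exact: mulmx1C.
  - exact: conjymx.
  - by rewrite trmxC_unitary.
have QT : Q *m T = Ac *m Q by rewrite defT !mulmxA QP mul1mx.
have TP : T *m P = P *m Ac by rewrite defT -mulmxA QP mulmx1.
have T0 j : complex.Re (T j j) != 0.
  apply: hA; have /eigenvalueP [v vT v0] : eigenvalue T (T j j).
    by rewrite eigenvalue_root_char char_poly_trig // (bigD1 j) //= rootM root_XsubC eqxx.
  apply/eigenvalueP; exists (v *m P).
    by rewrite -mulmxA -TP mulmxA vT scalemxAl.
  by apply: contraNneq v0 => vP0; rewrite -(mulmx1 v) -PQ mulmxA vP0 mul0mx.
have [g [c c0 hc]] := trig_lyapunov trigT T0.
pose Qr := map_mx (@complex.Re R) Q; pose Qi := map_mx (@complex.Im R) Q.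
pose D := diag_mx (\row_j g j).
have zr (w : 'rV[R]_n.+1) j :
    complex.Re ((map_mx (real_complex R) w *m Q) 0 j) = (w *m Qr) 0 j.
  rewrite !mxE Re_sum; apply: eq_bigr => i _; rewrite !mxE.
  by case: (Q i j) => a b /=; rewrite mul0r subr0.
have zi (w : 'rV[R]_n.+1) j :
    complex.Im ((map_mx (real_complex R) w *m Q) 0 j) = (w *m Qi) 0 j.
  rewrite !mxE Im_sum; apply: eq_bigr => i _; rewrite !mxE.
  by case: (Q i j) => a b /=; rewrite mul0r addr0.
exists (Qr *m D *m Qr^T + Qi *m D *m Qi^T); exists c.
  by split=> //; rewrite linearD /= !trmx_mul !trmxK tr_diag_mx !mulmxA.
move=> w; have := hc (map_mx (real_complex R) w *m Q).
rewrite -mulmxA QT mulmxA -map_mxM.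
have -> : \sum_j csq ((map_mx (real_complex R) w *m Q) 0 j) = sqn w.
  have QQ : Qr *m Qr^T + Qi *m Qi^T = 1%:M.
    have /unitarymxP e := Qu; apply/matrixP => i j.
    move/matrixP: e => /(_ i j) /(congr1 (@complex.Re R)).
    have dE : (i == j)%:R = complex.Re ((i == j)%:R : C) by case: (i == j).
    rewrite !mxE dE Re_sum -big_split /= => <-; apply: eq_bigr => k _.
    by rewrite !mxE; case: (Q i k) => a1 a2; case: (Q j k) => b1 b2 /=; ring.
  rewrite /sqn -QQ bilDm -{1}(mulmx1 Qr) -{1}(mulmx1 Qi).
  rewrite !bil_congr -!/(bil _ _ _) !dotE -big_split /=.
  by apply: eq_bigr => j _; rewrite /csq zr zi !expr2.
move=> /le_trans; apply; rewrite bilDm !bil_congr -!/(bil _ _ _) !bil_diag -big_split /=.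
rewrite le_eqVlt; apply/orP; left; apply/eqP; apply: eq_bigr => j _.
by rewrite !zr !zi mulrDr.
Qed.

End Lyapunov.
(** * Neighbourhoods, compactness and mean values *)

Section Calculus.
Context {R : realType}.

Lemma near_normP (V : normedModType (R : numFieldType)) (x : V) (P : V -> Prop) :
  (\forall u \near x, P u) <->
  exists2 e : R, 0 < e & forall u, `|u - x| < e -> P u.
Proof.
split=> [/nbhs_normP[e /= e0 h]|[e e0 h]].
  by exists e => // u ux; apply: h; rewrite /= distrC.
by apply/nbhs_normP; exists e => // u /= xu; apply: h; rewrite distrC.
Qed.

Lemma continuous_normP (V W : normedModType (R : numFieldType)) (f : V -> W) (x : V) :
  {for x, continuous f} <->
  forall e : R, 0 < e -> \forall u \near x, `|f u - f x| < e.
Proof.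
split=> [/cvgrPdist_lt h e e0|h]; last apply/cvgrPdist_lt => e e0.
  by near do rewrite distrC; exact: h.
by near do rewrite distrC; exact: h.
Unshelve. all: by end_near. Qed.

Lemma near_norm_ball (V : normedModType (R : numFieldType)) (x y : V) (r : R) :
  `|y - x| < r -> \forall u \near y, `|u - x| < r.
Proof.
move=> yr; apply/near_normP; exists (r - `|y - x|); first by rewrite subr_gt0.
move=> u ur; rewrite -(subrK y u) -addrA.
by apply: le_lt_trans (ler_normD _ _) _; rewrite -ltrBrDr.
Qed.

Lemma near_norm_neq (V : normedModType (R : numFieldType)) (x y : V) :
  x != y -> \forall u \near x, u != y.
Proof.
move=> xy; apply/near_normP; exists `|x - y|.
  by rewrite normr_gt0 subr_eq0.
by move=> u; apply: contraTneq => ->; rewrite distrC ltxx.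
Qed.

Lemma closed_ball_compact d (a : 'rV[R]_d) (r : R) :
  compact [set x | `|x - a| <= r].
Proof.
apply: bounded_closed_compact.
  exists (r + `|a|); split; first exact: num_real.
  move=> M rM x /= xr; apply/ltW/le_lt_trans/rM.
  by rewrite -{1}(subrK a x); apply: le_trans (ler_normD _ _) _; rewrite lerD2r.
have -> : [set x | `|x - a| <= r] = (fun x => `|x - a|) @^-1` [set t | t <= r] by [].
apply: closed_comp; last exact: closed_le.
move=> x _; apply/continuous_normP => e e0; apply/near_normP; exists e => // u ux.
by apply: le_lt_trans (ler_dist_dist _ _) _; rewrite opprB addrA subrK.
Qed.

(** Used for functions built from a gradient, over which nothing is known at the
    singularity: putting there the largest possible value keeps them upper
    semicontinuous. *)
Lemma usc_compact_max (T : topologicalType) (F : T -> R) (A : set T) :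
  A !=set0 -> compact A ->
  (forall x, A x -> forall e, 0 < e -> \forall y \near x, A y -> F y < F x + e) ->
  exists2 c, A c & forall t, A t -> F t <= F c.
Proof.
move=> [a Aa] /compact_near_coveringP/near_covering_withinP cA usc.
have [M FM] : exists M, forall x, A x -> F x < M.
  have : \forall M \near +oo, A `<=` (fun x => F x < M).
    apply: cA => x Ax.
    exists ([set y | A y -> F y < F x + 1], [set M | F x + 1 < M]) => /=.
      by split; [exact: usc|apply: nbhs_pinfty_gt; exact: num_real].
    by move=> [y M] /= [h hM] Ay; exact: lt_trans (h Ay) hM.
  by move=> /filter_ex[M hM]; exists M => x /hM.
have supF : has_sup (F @` A).
  split; first by exists (F a), a.
  by exists M => _ [x Ax <-]; exact/ltW/FM.
have leS x : A x -> F x <= sup (F @` A).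
  by move=> Ax; apply: sup_upper_bound => //; exists x.
apply: contrapT => nomax.
have ltS x : A x -> F x < sup (F @` A).
  move=> Ax; rewrite lt_neqAle leS // andbT; apply/eqP => eS.
  by apply: nomax; exists x => // t At; rewrite eS leS.
have : \forall s \near (sup (F @` A))^'-, A `<=` (fun x => F x < s).
  apply: cA => x Ax; have e0 : 0 < (sup (F @` A) - F x) / 2.
    by rewrite divr_gt0 // subr_gt0 ltS.
  exists ([set y | A y -> F y < F x + (sup (F @` A) - F x) / 2],
          [set s | F x + (sup (F @` A) - F x) / 2 < s]) => /=.
    by split; [exact: usc|apply: nbhs_left_gt; have := ltS x Ax; lra].
  by move=> [y s] /= [h hs] Ay; exact: lt_trans (h Ay) hs.
move=> hs; have : \forall s \near (sup (F @` A))^'-, s < sup (F @` A) /\ A `<=` (fun x => F x < s).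
  near=> s; split; first by near: s; exact: nbhs_left_lt.
  by near: s; exact: hs.
move=> /filter_ex[s [sS hA]].
have : sup (F @` A) <= s by apply: sup_le_ub; [exists (F a), a|move=> _ [x /hA/ltW ? <-]].
by rewrite leNgt sS.
Unshelve. all: by end_near. Qed.

Lemma is_diff_line (V : normedModType (R : numFieldType)) (x v : V) (t : R) :
  is_diff t (fun s : R => x + s *: v) (fun s => s *: v).
Proof.
have -> : (fun s : R => x + s *: v) = cst x + ( *:%R^~ v) by [].
by apply: is_diff_eq; rewrite add0r.
Qed.

Lemma is_derive_line (V : normedModType (R : numFieldType)) (g : V -> R) (x v : V) (t : R) :
  differentiable g (x + t *: v) ->
  is_derive t 1 (fun s : R => g (x + s *: v)) ('d g (x + t *: v) v).
Proof.
move=> dg; have dl := is_diff_line x v t.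
have dgl : differentiable (g \o (fun s : R => x + s *: v)) t.
  exact: differentiable_comp.
apply: DeriveDef; first exact: diff_derivable.
by rewrite deriveE // diff_comp //= diff_val scale1r.
Qed.

(** Only the restriction of [g] to the line through [x] directed by [v] matters. *)
Lemma diff_local_max (V : normedModType (R : numFieldType)) (g : V -> R) (x v : V) :
  (\forall u \near x, differentiable g u) ->
  (\forall u \near x, g u <= g x) -> 'd g x v = 0.
Proof.
move=> /near_normP[e e0 dg] /near_normP[r r0 gx].
pose m := Num.min e r.
have m0 : 0 < m by rewrite lt_min e0.
pose b := m / (`|v| + 1).
have b0 : 0 < b by rewrite divr_gt0 // ltr_wpDl.
have tb t : t \in `]-b, b[ -> `|x + t *: v - x| < m.
  rewrite in_itv /= -ltr_norml => tb.
  rewrite addrAC subrr add0r normrZ; apply: (@le_lt_trans _ _ (b * `|v|)).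
    by rewrite ler_wpM2r // ltW.
  by rewrite /b mulrAC ltr_pdivrMr ?ltr_pM2l ?ltrDl // ltr_wpDl.
have d t : t \in `]-b, b[ -> is_derive t 1 (fun s : R => g (x + s *: v)) ('d g (x + t *: v) v).
  move=> /tb h; apply: is_derive_line; apply: dg.
  by apply: lt_le_trans h _; rewrite ge_min lexx.
have b00 : 0 \in `](-b), b[ by rewrite in_itv /= oppr_lt0 b0.
have : is_derive (0 : R) 1 (fun s : R => g (x + s *: v)) 0.
  apply: (@derive1_at_max _ _ (- b) b) => //.
  - by rewrite ge0_cp // ltW.
  - by move=> t /d h; exact: ex_derive.
  - move=> t /tb h; rewrite scale0r addr0; apply: gx.
    by apply: lt_le_trans h _; rewrite ge_min lexx orbT.
have := d _ b00; rewrite scale0r addr0 => d0 d1.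
by rewrite -(@derive_val _ _ _ _ _ _ _ d0) (@derive_val _ _ _ _ _ _ _ d1).
Qed.

Lemma segment_MVT (V : normedModType (R : numFieldType)) (g : V -> R) (x y : V) :
  (forall t : R, 0 < t < 1 -> differentiable g (x + t *: (y - x))) ->
  {for x, continuous g} -> {for y, continuous g} ->
  exists2 t : R, 0 < t < 1 & g y - g x = 'd g (x + t *: (y - x)) (y - x).
Proof.
move=> dg cx cy.
have lc t : {for t, continuous (fun s : R => x + s *: (y - x))}.
  by apply: differentiable_continuous; have ? := is_diff_line x (y - x) t; exact: ex_diff.
have [] := @MVT _ (fun s : R => g (x + s *: (y - x)))
              (fun t => 'd g (x + t *: (y - x)) (y - x)) 0 1 ltr01.
- by move=> t; rewrite in_itv /= => /dg; exact: is_derive_line.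
- apply: continuous_in_subspaceT => t; rewrite inE /= in_itv /= => /andP[t0 t1].
  apply: (@continuous_comp _ _ _ (fun s : R => x + s *: (y - x)) g t (lc t)).
  have [->|tn0] := eqVneq t 0; first by rewrite scale0r addr0.
  have [->|tn1] := eqVneq t 1; first by rewrite scale1r [x + _]addrC subrK.
  apply/differentiable_continuous/dg.
  by rewrite lt_neqAle eq_sym tn0 t0 lt_neqAle tn1.
- move=> t; rewrite in_itv /= => t01.
  by rewrite scale0r addr0 scale1r [x + _]addrC subrK subr0 mulr1; exists t.
Qed.

End Calculus.
(** * Gradients and strict differentiability *)

Section Gradient.
Context {R : realType}.

(** The pointwise form of [Ck_on 1]: it makes sense at a single point and depends
    only on the germ of [f] there. *)
Definition C1_at (V W : normedModType (R : numFieldType)) (f : V -> W) (x : V) : Prop :=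
  (\forall u \near x, differentiable f u) /\
  forall v, {for x, continuous (fun u => 'd f u v)}.

(** Taking [df] as a bare linear function with a bound avoids bundling it before
    its linearity and continuity are known. *)
Lemma diff_normP (V W : normedModType (R : numFieldType)) (f : V -> W) (df : V -> W)
    (C : R) (x : V) : linear df -> (forall v, `|df v| <= C * `|v|) ->
  (forall e : R, 0 < e ->
     \forall u \near x, `|f u - f x - df (u - x)| <= e * `|u - x|) ->
  differentiable f x /\ forall v, 'd f x v = df v.
Proof.
move=> dfl dfC.
pose dfL : {linear V -> W} := HB.pack df (GRing.isLinear.Build _ _ _ _ df dfl).
rewrite -[df]/(dfL : V -> W) => h.
have cdf : continuous dfL.
  move=> y; apply/continuous_normP => e e0; apply/near_normP.
  exists (e / (`|C| + 1)); first by rewrite divr_gt0 // ltr_wpDl.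
  move=> u; rewrite ltr_pdivlMr ?ltr_wpDl // mulrC => uy.
  rewrite -linearB; apply: le_lt_trans (dfC _) _; apply: le_lt_trans uy.
  by rewrite ler_wpM2r // (le_trans (ler_norm _)) // lerDl.
have o : f \o shift x = cst (f x) + df +o_ 0 id.
  apply/eqaddoP => e e0; have /near_normP[r r0 hr] := h e e0.
  apply/near_normP; exists r => // u; rewrite subr0 => ur.
  have := hr (u + x); rewrite addrK => /(_ ur); rewrite /= !fctE /=.
  by rewrite opprD addrA.
have e := diff_unique cdf o; rewrite /= in e.
split=> [|v]; last by rewrite e.
apply/diff_locallyP; rewrite e; split=> //.
Qed.

Lemma diff_norm (V W : normedModType (R : numFieldType)) (f : V -> W) (x : V) :
  differentiable f x -> forall e : R, 0 < e ->
     \forall u \near x, `|f u - f x - 'd f x (u - x)| <= e * `|u - x|.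
Proof.
move=> /diff_locallyP[_ /eqaddoP h] e e0; have /near_normP[r r0 hr] := h e e0.
apply/near_normP; exists r => // u ur.
have := hr (u - x); rewrite subr0 => /(_ ur); rewrite /= !fctE /= subrK.
by rewrite opprD addrA.
Qed.

Lemma near_eq_diff (V W : normedModType (R : numFieldType)) (f g : V -> W) (x : V) :
  (\forall u \near x, f u = g u) -> differentiable f x ->
  differentiable g x /\ forall v, 'd g x v = 'd f x v.
Proof.
move=> fg df; have cdf := diff_continuous df.
have o : g \o shift x = cst (g x) + 'd f x +o_ 0 id.
  apply/eqaddoP => e e0.
  have /near_normP[r r0 hr] : \forall u \near x, f u = g u /\
      `|f u - f x - 'd f x (u - x)| <= e * `|u - x|.
    by have h := diff_norm df e0; near=> u; split; near: u.
  apply/near_normP; exists r => // u; rewrite subr0 => ur.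
  have := hr (u + x); rewrite addrK => /(_ ur)[fgu]; rewrite /= !fctE /= -fgu.
  by rewrite -(nbhs_singleton fg) opprD addrA.
have e := diff_unique cdf o.
split=> [|v]; last by rewrite e.
by apply/diff_locallyP; rewrite e; split.
Unshelve. all: by end_near. Qed.

Context {d : nat}.
Local Notation V := 'rV[R]_d.
Implicit Types (g : V -> R) (x y v w : V).

Definition grad g x : V := \row_i 'd g x 'e_i.

Lemma diff_grad g x v : 'd g x v = bil 1%:M v (grad g x).
Proof.
rewrite dotE {1}(row_sum_delta v) linear_sum; apply: eq_bigr => i _.
by rewrite linearZ /= mxE.
Qed.

Lemma continuous_grad g x : C1_at g x -> {for x, continuous (grad g)}.
Proof.
move=> [_ gc]; apply/continuous_normP => e e0.
have e20 : 0 < e / 2 by rewrite divr_gt0.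
have h : \forall u \near x, forall i, `|'d g u 'e_i - 'd g x 'e_i| < e / 2.
  apply: (@filter_forall _ _ (fun i u => `|'d g u 'e_i - 'd g x 'e_i| < e / 2) (nbhs x) _) => i.
  by have /continuous_normP := gc 'e_i; apply.
near=> u; apply: (@le_lt_trans _ _ (e / 2)); last by lra.
apply: norm_le_coord => [|i]; first exact: ltW.
by rewrite !mxE ltW //; move: i; near: u.
Unshelve. all: by end_near. Qed.

Lemma segment_ball (x1 x y : V) (r t : R) : 0 < t < 1 ->
  `|x - x1| < r -> `|y - x1| < r -> `|x + t *: (y - x) - x1| < r.
Proof.
move=> /andP[t0 t1] xr yr.
have -> : x + t *: (y - x) - x1 = (1 - t) *: (x - x1) + t *: (y - x1).
  by apply/rowP => i; rewrite !mxE; ring.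
apply: le_lt_trans (ler_normD _ _) _; rewrite !normrZ.
by rewrite (gtr0_norm t0) gtr0_norm ?subr_gt0 //; nra.
Qed.

Lemma row_MVT g (x y x1 : V) (r : R) : `|x - x1| < r -> `|y - x1| < r ->
  (forall z, `|z - x1| < r -> differentiable g z) ->
  exists2 z, `|z - x1| < r & g y - g x = 'd g z (y - x).
Proof.
move=> xr yr dg; have [|||t t01 e] := @segment_MVT _ _ g x y.
- by move=> t t01; apply: dg; exact: segment_ball.
- exact/differentiable_continuous/dg.
- exact/differentiable_continuous/dg.
by exists (x + t *: (y - x)); first exact: segment_ball.
Qed.

Lemma diff_sub_le g z x v :
  `|'d g z v - 'd g x v| <= mxbound (1%:M : 'M[R]_d) * `|v| * `|grad g z - grad g x|.
Proof.
have E : 'd g z v - 'd g x v = bil 1%:M v (grad g z - grad g x).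
  rewrite bilBr; exact: (congr2 (fun a b => a - b) (diff_grad g z v) (diff_grad g x v)).
by rewrite E; exact: bil_le.
Qed.

Lemma C1_strict_scalar g x1 : C1_at g x1 -> forall e : R, 0 < e ->
  exists2 r : R, 0 < r & forall x y, `|x - x1| < r -> `|y - x1| < r ->
    `|g y - g x - 'd g x1 (y - x)| <= e * `|y - x|.
Proof.
move=> g1 e e0; have [/near_normP[r1 r10 dg] _] := g1.
have B0 := mxbound_ge0 (1%:M : 'M[R]_d).
have eB0 : 0 < e / (mxbound (1%:M : 'M[R]_d) + 1).
  by rewrite divr_gt0 // ltr_wpDl.
have /continuous_normP/(_ _ eB0)/near_normP[r2 r20 cg] := continuous_grad g1.
exists (Num.min r1 r2); first by rewrite lt_min r10.
move=> x y xr yr.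
have [|z] := @row_MVT g x y x1 (Num.min r1 r2) xr yr.
  by move=> z; rewrite lt_min => /andP[/dg].
rewrite lt_min => /andP[_ /cg/ltW h] ->.
apply: le_trans (diff_sub_le _ _ _ _) _; rewrite mulrAC ler_wpM2r //.
apply: le_trans (ler_wpM2l B0 h) _; rewrite mulrCA ler_piMr ?ltW //.
by rewrite ltr_pdivrMr ?mul1r ?ltrDl // ltr_wpDl.
Qed.

Lemma diff_coord m (X : V -> 'rV[R]_m) x v j : differentiable X x ->
  differentiable (fun u => X u 0 j) x /\
  'd (fun u => X u 0 j) x v = 'd X x v 0 j.
Proof.
move=> dX; have dXj : differentiable (fun u => X u 0 j) x.
  by apply: (@differentiable_comp _ _ _ _ X (fun M : 'rV[R]_m => M 0 j)) => //;
     exact: differentiable_coord.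
split=> //; rewrite -!deriveE // derive_mx ?mxE //.
exact: diff_derivable.
Qed.

Lemma diff_jacobian m (X : V -> 'rV[R]_m) x v : 'd X x v = v *m 'J X x.
Proof. by rewrite /jacobian mul_rV_lin1. Qed.

Lemma C1_coord m (X : V -> 'rV[R]_m) x j :
  C1_at X x -> C1_at (fun u => X u 0 j) x.
Proof.
move=> [dX cX]; split.
  by apply: filterS dX => u /diff_coord h; have [] := h 0 j.
move=> v; apply/continuous_normP => e e0.
have /continuous_normP/(_ e e0) := cX v; apply: filterS2 (dX) => u du.
have dx := nbhs_singleton dX.
have E : 'd (fun u => X u 0 j) u v - 'd (fun u => X u 0 j) x v =
         ('d X u v - 'd X x v) 0 j.
  rewrite !mxE.
  exact: (congr2 (fun a b => a - b) (diff_coord v j du).2 (diff_coord v j dx).2).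
rewrite E; apply: le_lt_trans; exact: coord_norm_le.
Qed.

(** Strict differentiability: unlike the definition of the derivative, both points
    move. This is what controls differences of [X] at two nearby points, and
    difference quotients based at a moving point. *)
Lemma C1_strict m (X : V -> 'rV[R]_m) x1 : C1_at X x1 ->
  forall e : R, 0 < e ->
  exists2 r : R, 0 < r & forall x y, `|x - x1| < r -> `|y - x1| < r ->
    `|X y - X x - (y - x) *m 'J X x1| <= e * `|y - x|.
Proof.
move=> X1 e e0.
have h : \forall r \near 0^'+, forall j, forall x y, `|x - x1| < r -> `|y - x1| < r ->
    `|X y 0 j - X x 0 j - ((y - x) *m 'J X x1) 0 j| <= e * `|y - x|.
  apply: (@filter_forall _ _ (fun j r => forall x y, `|x - x1| < r ->
     `|y - x1| < r -> `|X y 0 j - X x 0 j - ((y - x) *m 'J X x1) 0 j|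
       <= e * `|y - x|) (0^'+) _) => j.
  have [r r0 hr] := C1_strict_scalar (C1_coord j X1) e0.
  near=> s => x y xs ys.
  have sr : s <= r by near: s; exact: nbhs_right_le.
  have := hr x y (lt_le_trans xs sr) (lt_le_trans ys sr).
  have [_ ->] := diff_coord (y - x) j (nbhs_singleton X1.1).
  by rewrite diff_jacobian.
have [r [r0 hr]] : exists r : R, 0 < r /\ forall j, forall x y,
    `|x - x1| < r -> `|y - x1| < r ->
    `|X y 0 j - X x 0 j - ((y - x) *m 'J X x1) 0 j| <= e * `|y - x|.
  apply: (@filter_ex _ (0^'+)); near=> s; split; first by near: s; exact: nbhs_right_gt.
  by near: s.
exists r => // x y xr yr; apply: norm_le_coord => [|j].
  by rewrite mulr_ge0 // ltW.
by rewrite !mxE; have := hr j x y xr yr; rewrite !mxE.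
Unshelve. all: by end_near. Qed.

Lemma diff_bil_self (S : 'M[R]_d) a x : S^T = S ->
  differentiable (fun u : V => bil S (u - a) (u - a)) x /\
  forall v, 'd (fun u : V => bil S (u - a) (u - a)) x v = 2 * bil S (x - a) v.
Proof.
move=> hS; apply: (@diff_normP _ _ _ (fun v => 2 * bil S (x - a) v)
                     (2 * (mxbound S * `|x - a|))).
- by move=> b u v; rewrite bilDr bilZr /GRing.scale /=; ring.
- by move=> v; rewrite normrM ger0_norm // -mulrA ler_wpM2l // bil_le.
move=> e e0; apply/near_normP; exists (e / (mxbound S + 1)).
  by rewrite divr_gt0 // ltr_wpDl ?mxbound_ge0.
move=> u; rewrite ltr_pdivlMr ?ltr_wpDl ?mxbound_ge0 // mulrC => /ltW ux.
have -> : bil S (u - a) (u - a) - bil S (x - a) (x - a) - 2 * bil S (x - a) (u - x)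
  = bil S (u - x) (u - x).
  by rewrite !(bilBl, bilBr) (bilC u x hS) (bilC a x hS) (bilC a u hS); ring.
apply: le_trans (bil_le _ _ _) _; rewrite ler_wpM2r //.
by apply: le_trans ux; rewrite ler_wpM2r // lerDl.
Qed.

Lemma cvg_bil (S : 'M[R]_d) (T : Type) (F : set_system T) (FF : Filter F)
    (f g : T -> V) (a b : V) :
  f @ F --> a -> g @ F --> b -> bil S (f t) (g t) @[t --> F] --> bil S a b.
Proof.
move=> fa gb; apply/cvgrPdist_le => e e0.
have M0 := mxbound_ge0 S.
pose N : R := (mxbound S + 1) * (`|a| + `|b| + 1).
have N0 : 0 < N by rewrite mulr_gt0 // ?ltr_wpDl ?addr_ge0.
pose e1 := Num.min 1 (e / N).
have e10 : 0 < e1 by rewrite lt_min ltr01 divr_gt0.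
have /cvgrPdist_le/(_ _ e10) fa1 := fa; have /cvgrPdist_le/(_ _ e10) gb1 := gb.
apply: filterS2 fa1 gb1 => t ft gt.
have -> : bil S a b - bil S (f t) (g t)
        = bil S (a - f t) (g t) + bil S a (b - g t).
  by rewrite !(bilBl, bilBr); ring.
have gt1 : `|g t| <= `|b| + 1.
  rewrite -(subrK b (g t)) addrC; apply: le_trans (ler_normD _ _) _.
  rewrite lerD2l distrC; apply: le_trans gt _.
  by rewrite ge_min lexx.
apply: le_trans (ler_normD _ _) _.
apply: (@le_trans _ _ (mxbound S * e1 * (`|b| + 1) + mxbound S * `|a| * e1)).
  apply: lerD; apply: le_trans (bil_le _ _ _) _.
    by apply: ler_pM => //; [exact: mulr_ge0|exact: ler_wpM2l].
  by rewrite ler_wpM2l // mulr_ge0.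
apply: (@le_trans _ _ (e1 * N)).
  rewrite /N -subr_ge0.
  have -> : e1 * ((mxbound S + 1) * (`|a| + `|b| + 1)) -
    (mxbound S * e1 * (`|b| + 1) + mxbound S * `|a| * e1) = e1 * (`|a| + `|b| + 1) by ring.
  by rewrite mulr_ge0 ?addr_ge0 // ltW.
by rewrite -ler_pdivlMr // ge_min lexx orbT.
Qed.

End Gradient.
(** * First-order conditions along a vector field *)

Section MaximumPrinciple.
Context {R : realType} {d : nat}.
Local Notation V := 'rV[R]_d.
Implicit Types (X : V -> V) (g u z : V -> R) (x y a : V) (S : 'M[R]_d).

(** Near [x0], [u] is a uniform limit of differentiable functions that do not
    decrease along [X]. A quadratic form in the gradient of a C1 function is only
    continuous, so it has no derivative along [X] to speak of; this notion
    replaces the sign of that derivative, and is all that first-order conditions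
    at a maximum require. *)
Definition incr_along X u x0 := exists2 r : R, 0 < r &
  forall e : R, 0 < e -> exists w : V -> R, forall x, `|x - x0| < r ->
    [/\ differentiable w x, `|w x - u x| <= e & 0 <= 'd w x (X x)].

(** If the derivative of [g] along [X] were positive at [x0], subtract the square
    distance to [x0], whose derivative along [X] is small near [x0], to make the
    maximum of [g + z] strict. It then persists, slightly displaced, when [z] is
    replaced by a good approximation [w] that does not decrease along [X]; there
    the derivative along [X] of a function at an interior maximum would be
    positive. *)
Lemma local_max_incr X g z x0 :
  (\forall x \near x0, differentiable g x) -> {for x0, continuous X} ->
  {for x0, continuous (fun x => 'd g x (X x))} -> incr_along X z x0 ->
  (\forall x \near x0, g x + z x <= g x0 + z x0) -> 'd g x0 (X x0) <= 0.
Proof.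
move=> dg Xc dgc [r r0 zw] gz; rewrite leNgt; apply/negP.
pose D x : R := 'd g x (X x).
have {}dgc : {for x0, continuous D} by [].
rewrite -[_ (X x0)]/(D x0); move cE : (D x0 : R) => c dg0.
have M0 := mxbound_ge0 (1%:M : 'M[R]_d).
pose M := mxbound (1%:M : 'M[R]_d) * (`|X x0| + 1) + 1.
have M1 : 0 < M by rewrite ltr_wpDl // mulr_ge0 // addr_ge0.
have [r1 r10 h1] : exists2 r1 : R, 0 < r1 & forall x, `|x - x0| < r1 ->
    [/\ differentiable g x, g x + z x <= g x0 + z x0, c / 2 < D x &
        `|X x| <= `|X x0| + 1].
  apply/near_normP.
  have c20 : 0 < c / 2 by rewrite divr_gt0.
  have /continuous_normP/(_ _ c20) hc := dgc.
  have /continuous_normP/(_ _ ltr01) hX := Xc.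
  near=> x; split.
  - by near: x.
  - by near: x.
  - have : `|D x - D x0| < c / 2 by near: x.
    by rewrite cE ltr_norml => /andP[+ _]; lra.
  - rewrite -(subrK (X x0) (X x)) addrC; apply: le_trans (ler_normD _ _) _.
    by rewrite lerD2l ltW //; near: x.
pose rho := Num.min (Num.min r r1) (c / (8 * M)) / 2.
have m0 : 0 < Num.min (Num.min r r1) (c / (8 * M)).
  by rewrite !lt_min r0 r10 divr_gt0 // mulr_gt0.
have rho0 : 0 < rho by rewrite divr_gt0.
have [rho_r rho_r1 rho_c] : [/\ rho < r, rho < r1 & rho < c / (8 * M)].
  have : rho < Num.min (Num.min r r1) (c / (8 * M)) by rewrite /rho; lra.
  by rewrite !lt_min => /andP[/andP[]].
pose q x := bil 1%:M (x - x0) (x - x0).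
have dq x : differentiable q x /\ forall v, 'd q x v = 2 * bil 1%:M (x - x0) v.
  by apply: diff_bil_self; rewrite trmx1.
(* The penalty [q] is at least [rho ^+ 2] on the sphere of radius [rho], so an
   approximation within a quarter of that keeps the maximum inside. *)
have e0 : 0 < rho ^+ 2 / 4 by rewrite divr_gt0 // exprn_gt0.
have [w hw] := zw _ e0.
pose K := [set x | `|x - x0| <= rho].
have Kr x : K x -> `|x - x0| < r by move=> /= /le_lt_trans; apply.
have Kr1 x : K x -> `|x - x0| < r1 by move=> /= /le_lt_trans; apply.
pose Phi : V -> R := g + w - q.
have dgw x : K x -> differentiable (g + w) x.
  move=> Kx; have [? _ _ _] := h1 x (Kr1 _ Kx); have [? _ _] := hw x (Kr _ Kx).
  exact: differentiableD.
have dPhi x : K x -> differentiable Phi x.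
  by move=> Kx; apply: differentiableB; [exact: dgw|exact: (dq x).1].
have [|||y Ky maxy] := @compact_EVT_max V R Phi K.
- by exists x0; rewrite /K /= subrr normr0 ltW.
- exact: closed_ball_compact.
- apply: continuous_in_subspaceT => x; rewrite inE => /dPhi.
  exact: differentiable_continuous.
rewrite inE in Ky.
have Kx0 : K x0 by rewrite /K /= subrr normr0 ltW.
have yrho : `|y - x0| < rho.
  rewrite lt_neqAle Ky andbT; apply/eqP => yrho.
  have := maxy x0; rewrite inE => /(_ Kx0); rewrite /Phi /= !fctE /=.
  have : rho ^+ 2 <= q y by rewrite -yrho; exact: sqr_norm_le_sqn.
  have -> : q x0 = 0 by rewrite /q subrr bil0l.
  have [_ gy _ _] := h1 y (Kr1 _ Ky).
  have [_ + _] := hw y (Kr _ Ky); have [_ + _] := hw x0 (Kr _ Kx0).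
  rewrite !ler_norml => /andP[A1 A2] /andP[B1 B2]; move: gy A1 A2 B1 B2 e0.
  by move: (rho ^+ 2) => s; lra.
have dPhi0 : 'd Phi y (X y) = 0.
  have nb : \forall x \near y, `|x - x0| < rho := near_norm_ball yrho.
  apply: diff_local_max; near=> x; first by apply: dPhi; apply: ltW; near: x.
  by apply: maxy; rewrite inE; apply: ltW; near: x.
have [dgy _ cy Xy] := h1 y (Kr1 _ Ky); have [dwy _ wy] := hw y (Kr _ Ky).
have E : 'd Phi y (X y) = D y + 'd w y (X y) - 2 * bil 1%:M (y - x0) (X y).
  have e1 := congr1 (fun F : V -> R => F (X y)) (diffB (dgw _ Ky) (dq y).1).
  have e2 := congr1 (fun F : V -> R => F (X y)) (diffD dgy dwy).
  exact: (etrans e1 (congr2 (fun s t => s - t) e2 ((dq y).2 (X y)))).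
have hq : 2 * bil 1%:M (y - x0) (X y) <= c / 4.
  move b_def : (bil 1%:M (y - x0) (X y)) => b.
  have : `|b| <= rho * M.
    rewrite -b_def.
    apply: le_trans (bil_le _ _ _) _; rewrite mulrAC mulrC.
    apply: ler_pM => //; first by rewrite mulr_ge0.
    by apply: ler_wpDr => //; exact: ler_wpM2l.
  have : rho * M <= c / 8.
    have -> : c / 8 = c / (8 * M) * M by field; rewrite gt_eqF.
    by rewrite ler_wpM2r // ltW.
  move: (rho * M) => s s8; rewrite ler_norml => /andP[_ bs].
  by clear -s8 bs; lra.
move: (etrans (esym E) dPhi0) hq cy wy dg0; clear.
move: (D y : R) ('d w y (X y) : R) (bil _ _ _) => p1 p2 p3.
by lra.
Unshelve. all: by end_near. Qed.

(** The function [v |-> - t / (v - m)] is smooth and increasing for [v > m], hence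
    preserves limits of functions that do not decrease along [X]. *)
Lemma incr_along_penalty X u x0 z (m t : R) : {for x0, continuous u} ->
  incr_along X u x0 -> m < u x0 -> 0 < t ->
  (\forall x \near x0, z x = - (t / (u x - m))) -> incr_along X z x0.
Proof.
move=> uc [r r0 uw] mu t0 hz.
pose k := (u x0 - m) / 2.
have k0 : 0 < k by rewrite divr_gt0 // subr_gt0.
have [r1 r10 h1] : exists2 r1 : R, 0 < r1 & forall x, `|x - x0| < r1 ->
    z x = - (t / (u x - m)) /\ k < u x - m.
  apply/near_normP; have /continuous_normP/(_ _ k0) hu := uc.
  near=> x; split; first by near: x.
  have : `|u x - u x0| < k by near: x.
  by rewrite ltr_norml => /andP[+ _]; rewrite /k; lra.
exists (Num.min r r1); first by rewrite lt_min r0.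
move=> e e0; pose e1 := Num.min (k / 2) (e * k ^+ 2 / (2 * t)).
have e10 : 0 < e1.
  have ek : 0 < e * k ^+ 2 by rewrite mulr_gt0 // exprn_gt0.
  have t2 : 0 < 2 * t by rewrite mulr_gt0.
  by rewrite lt_min (divr_gt0 ek t2) divr_gt0.
have [w hw] := uw _ e10.
exists ((- t) *: (fun x => ((w - cst m) x)^-1) : V -> R).
move=> x; rewrite lt_min => /andP[/hw[dw wu dwX] /h1[-> ku]].
have wk : k / 2 < w x - m.
  have : `|w x - u x| <= k / 2 by apply: le_trans wu _; rewrite ge_min lexx.
  by rewrite ler_norml => /andP[+ _]; move: ku; clear; lra.
have wm0 : w x - m != 0 by rewrite gt_eqF //; lra.
have dwm : differentiable (w - cst m) x by apply: differentiableB.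
have dV : differentiable (fun x => ((w - cst m) x)^-1) x.
  exact: differentiableV.
split; first exact: differentiableZ.
- have um0 : u x - m != 0 by rewrite gt_eqF //; lra.
  have -> : ((- t) *: (fun x => ((w - cst m) x)^-1) : V -> R) x - - (t / (u x - m))
     = t * (w x - u x) / ((w x - m) * (u x - m)).
    rewrite /= !fctE /= /GRing.scale /=; field.
    by rewrite um0 wm0.
  have p0 : 0 < (w x - m) * (u x - m) by rewrite mulr_gt0 //; lra.
  rewrite normrM normfV (gtr0_norm p0) ler_pdivrMr // normrM gtr0_norm //.
  apply: (@le_trans _ _ (e * k ^+ 2 / 2)).
    have -> : e * k ^+ 2 / 2 = t * (e * k ^+ 2 / (2 * t)) by field; rewrite gt_eqF.
    apply: ler_wpM2l; first exact: ltW.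
    by apply: le_trans wu _; rewrite ge_min lexx orbT.
  rewrite -mulrA ler_wpM2l ?ltW //.
  have : 0 < (w x - m - k / 2) * (u x - m) by rewrite mulr_gt0; lra.
  have : 0 < k * (u x - m - k) by rewrite mulr_gt0; lra.
  by rewrite expr2; lra.
rewrite diffZ // /= diffV // /= diffB // /= diff_cst /= subr0.
rewrite /GRing.scale /= mulNr mulNr mulrN opprK.
by rewrite !mulr_ge0 ?invr_ge0 ?exprn_even_ge0 // ltW.
Unshelve. all: by end_near. Qed.

End MaximumPrinciple.
(** * The maximum principle at a saddle *)

Section SaddleMaximum.
Context {R : realType} {d : nat}.
Local Notation V := 'rV[R]_d.
Implicit Types (X : V -> V) (u : V -> R) (x y a : V) (S : 'M[R]_d).

(** An increasing function of [u] with values between [- t / i] and [0], equal to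
    [- t / i] unless [u > m + i]. At the singularity [a], where [u] is not controlled, it
    takes its supremum [0]: this keeps it upper semicontinuous, and is harmless
    because [a] does not move. *)
Definition penalty u a (m t i : R) x : R :=
  if x == a then 0 else - (t / Num.max (u x - m) i).

Lemma penalty_le0 u a m t i x : 0 < t -> 0 < i -> penalty u a m t i x <= 0.
Proof.
move=> t0 i0; rewrite /penalty; case: ifP => // _; rewrite oppr_le0.
by apply: divr_ge0; first exact: ltW; rewrite le_max (ltW i0) orbT.
Qed.

Lemma penalty_usc u a m t i x : 0 < t -> 0 < i ->
  (x != a -> {for x, continuous u}) ->
  forall e, 0 < e -> \forall y \near x, penalty u a m t i y < penalty u a m t i x + e.
Proof.
move=> t0 i0 uc e e0; have [->|xa] := eqVneq x a.
  near=> y; apply: le_lt_trans (penalty_le0 _ _ _ _ t0 i0) _.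
  by rewrite /penalty eqxx add0r.
have e10 : 0 < e * i ^+ 2 / t by rewrite divr_gt0 // mulr_gt0 // exprn_gt0.
have /continuous_normP/(_ _ e10) hu := uc xa.
have nxa : \forall y \near x, y != a by exact: near_norm_neq.
near=> y; have ya : y != a by near: y.
rewrite /penalty (negPf xa) (negPf ya).
have : `|u y - u x| < e * i ^+ 2 / t by near: y.
have hP : i <= Num.max (u y - m) i by rewrite le_max lexx orbT.
have hQ : i <= Num.max (u x - m) i by rewrite le_max lexx orbT.
have : `|Num.max (u y - m) i - Num.max (u x - m) i| <= `|u y - u x|.
  have := ler_norm (u y - u x); have := ler_norm (- (u y - u x)).
  have := normr_ge0 (u y - u x); rewrite normrN.
  move: `|u y - u x| (u x) (u y) => n ux uy h1 h2 h3; rewrite ler_norml !maxEle.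
  by case: (leP (uy - m) i) => ?; case: (leP (ux - m) i) => ?; apply/andP; split; lra.
move: hP hQ; move: (Num.max (u y - m) i) (Num.max (u x - m) i) => P Q hP hQ /le_lt_trans h /h.
rewrite ltr_pdivlMr // => PQ.
have P0 : 0 < P by exact: lt_le_trans i0 hP.
have Q0 : 0 < Q by exact: lt_le_trans i0 hQ.
have iPQ : i ^+ 2 <= P * Q by rewrite expr2 ler_pM // ltW.
rewrite -subr_gt0.
have -> : - (t / Q) + e - - (t / P) = (e * (P * Q) - (P - Q) * t) / (P * Q).
  by field; rewrite !gt_eqF.
rewrite divr_gt0 ?mulr_gt0 // subr_gt0.
apply: (@le_lt_trans _ _ (`|P - Q| * t)); first by apply: ler_wpM2r; [exact: ltW|exact: ler_norm].
by apply: lt_le_trans PQ _; apply: ler_wpM2l => //; exact: ltW.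
Unshelve. all: by end_near. Qed.

Lemma bil_self_bound S (r : R) x y a : `|x - a| <= r -> `|y - a| <= r ->
  bil S (x - y) (x - y) < mxbound S * (2 * r) ^+ 2 + 1.
Proof.
move=> xr yr; apply: (@le_lt_trans _ _ (mxbound S * (2 * r) ^+ 2)); last by rewrite ltrDl.
apply: le_trans (ler_norm _) _; apply: le_trans (bil_le _ _ _) _.
have xy : `|x - y| <= 2 * r.
  have -> : x - y = (x - a) - (y - a) by rewrite opprB addrA subrK.
  by apply: le_trans (ler_normB _ _) _; lra.
by rewrite -mulrA -expr2 ler_wpM2l ?mxbound_ge0 // lerXn2r ?nnegrE // (le_trans _ xy).
Qed.

(** One half of the first-order condition at a maximum [(p, q)] of
    [L(x - y) + penalty x + penalty y]: [p] is a local maximum when [q] is fixed,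
    so the derivative of [L(. - q)] along [X] at [p] is nonpositive. The relation
    between [t / i] and the size of [L] on the ball excludes the region where the
    penalty is truncated, so [u p > m] and [p] is interior. If [p = a], the
    conclusion holds because [X a = 0]. *)
Lemma penalized_max_le0 X S u a (r m t i : R) (p q : V) : S^T = S ->
  0 < t -> 0 < i -> t / i = mxbound S * (2 * r) ^+ 2 + 1 ->
  X a = 0 -> (forall x, `|x - a| <= r -> {for x, continuous X}) ->
  (forall x, `|x - a| <= r -> x != a -> {for x, continuous u}) ->
  (forall x, `|x - a| = r -> u x <= m) ->
  (forall x, `|x - a| < r -> x != a -> m < u x -> incr_along X u x) ->
  `|p - a| <= r -> `|q - a| <= r ->
  0 < bil S (p - q) (p - q) + penalty u a m t i p ->
  (forall x, `|x - a| <= r ->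
     bil S (x - q) (x - q) + penalty u a m t i x <=
     bil S (p - q) (p - q) + penalty u a m t i p) ->
  bil S (p - q) (X p) <= 0.
Proof.
move=> hS t0 i0 ti Xa Xc uc usph uincr pr qr pos maxp.
have [->|pa] := eqVneq p a; first by rewrite Xa bil0r.
have up : m + i < u p.
  rewrite ltNge; apply/negP => upm; move: pos.
  rewrite /penalty (negPf pa) (max_idPr _); last by rewrite lerBlDl.
  by rewrite ti subr_gt0 ltNge ltW // (bil_self_bound _ pr qr).
have mup : m < u p by apply: lt_trans up; rewrite ltrDl.
have pr' : `|p - a| < r.
  by rewrite lt_neqAle pr andbT; apply/eqP => /usph; rewrite leNgt mup.
pose g x := bil S (x - q) (x - q).
have dg x : differentiable g x /\ forall v, 'd g x v = 2 * bil S (x - q) v.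
  exact: diff_bil_self.
have ucp := uc p pr pa.
have i1 : \forall x \near p, i < u x - m.
  have e0 : 0 < u p - m - i by lra.
  have /continuous_normP/(_ _ e0) h := ucp; apply: filterS h => x.
  by rewrite ltr_norml => /andP[+ _]; lra.
have : 'd g p (X p) <= 0.
  apply: (@local_max_incr _ _ X g (penalty u a m t i)).
  - by near=> x; exact: (dg x).1.
  - exact: Xc.
  - have -> : (fun x => 'd g x (X x)) = (fun x => bil (2 *: S) (x - q) (X x)).
      by apply/funext => x; rewrite bilZm; exact: (dg x).2.
    have cq : {for p, continuous (fun x => x - q)}.
      by apply/continuous_normP => e e0; apply/near_normP; exists e => // x;
         rewrite opprB addrA subrK.
    exact: (cvg_bil _ cq (Xc p pr)).
  - apply: (incr_along_penalty ucp (uincr p pr' pa mup) mup t0).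
    have na : \forall x \near p, x != a by exact: near_norm_neq.
    near=> x; have xa : x != a by near: x.
    rewrite /penalty (negPf xa) (max_idPl _) // ltW //.
    by near: x.
  - have nr : \forall x \near p, `|x - a| < r by exact: near_norm_ball.
    by near=> x; apply: maxp; apply: ltW; near: x.
by rewrite (dg p).2 pmulr_rle0.
Unshelve. all: by end_near. Qed.

(** Let [L] be the quadratic form of [S]. If [u > m] at [x0], then [u > m] near
    [x0], in particular at some [y0] such that [L(x0 - y0) > 0]. For a weak enough
    penalty, [L(x - y) + penalty x + penalty y] is then positive at [(x0, y0)];
    take a maximum [(p, q)] of it over pairs of points of the ball. Moving [p] and
    [q] along [X] does not decrease the penalties but strictly increases
    [L(p - q)], which contradicts the first-order conditions at [(p, q)]. The
    existence of a direction on which [L > 0] is what distinguishes saddles and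
    sources from sinks, where the conclusion fails. *)
Theorem saddle_maximum_principle X S u a (r m : R) : S^T = S ->
  X a = 0 -> (forall x, `|x - a| <= r -> {for x, continuous X}) ->
  (forall x y, `|x - a| <= r -> `|y - a| <= r -> x != y ->
     0 < bil S (x - y) (X x - X y)) ->
  (exists w, 0 < bil S w w) ->
  (forall x, `|x - a| <= r -> x != a -> {for x, continuous u}) ->
  (forall x, `|x - a| = r -> u x <= m) ->
  (forall x, `|x - a| < r -> x != a -> m < u x -> incr_along X u x) ->
  forall x, `|x - a| <= r -> x != a -> u x <= m.
Proof.
move=> hS Xa Xc mono [w1 w1S] uc usph uincr x0 x0r x0a.
rewrite leNgt; apply/negP => mu.
have x0r' : `|x0 - a| < r.
  by rewrite lt_neqAle x0r andbT; apply/eqP => /usph; rewrite leNgt mu.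
have [y0 [y0r y0a muy l0]] : exists y0, [/\ `|y0 - a| <= r, y0 != a, m < u y0 &
    0 < bil S (x0 - y0) (x0 - y0)].
  have : \forall y \near x0, [/\ `|y - a| < r, y != a & m < u y].
    have e0 : 0 < u x0 - m by rewrite subr_gt0.
    have /continuous_normP/(_ _ e0) h := uc x0 x0r x0a.
    have nr : \forall y \near x0, `|y - a| < r by exact: near_norm_ball.
    have na : \forall y \near x0, y != a by exact: near_norm_neq.
    near=> y; split; [by near: y|by near: y|].
    have : `|u y - u x0| < u x0 - m by near: y.
    by rewrite ltr_norml => /andP[+ _]; lra.
  move=> /near_normP[e e0 he]; pose s := e / (`|w1| + 1).
  have s0 : 0 < s by rewrite divr_gt0 // ltr_wpDl.
  have [|h1 h2 h3] := he (x0 + s *: w1).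
    rewrite addrAC subrr add0r normrZ gtr0_norm //.
    by rewrite /s mulrAC ltr_pdivrMr ?ltr_pM2l ?ltrDl // ltr_wpDl.
  exists (x0 + s *: w1); split=> //; first exact: ltW.
  have -> : x0 - (x0 + s *: w1) = - s *: w1 by rewrite opprD addrA subrr add0r scaleNr.
  by rewrite bilZl bilZr mulrA mulrNN !mulr_gt0.
set l := bil S (x0 - y0) (x0 - y0) in l0.
have r0 : 0 <= r by rewrite (le_trans _ x0r).
pose eta := Num.min (u x0 - m) (u y0 - m).
have eta0 : 0 < eta by rewrite lt_min !subr_gt0 mu.
pose Lm := mxbound S * (2 * r) ^+ 2 + 1.
have Lm0 : 0 < Lm by rewrite ltr_wpDl // mulr_ge0 ?mxbound_ge0 // sqr_ge0.
(* With this [t] each of the two penalties at [(x0, y0)] costs at most a quarter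
   of [L(x0 - y0)]; [i] is then imposed by [penalized_max_le0]. *)
pose t := l * eta / 4; have t0 : 0 < t by rewrite !mulr_gt0 // invr_gt0.
pose i := t / Lm; have i0 : 0 < i by rewrite divr_gt0.
have ti : t / i = Lm by rewrite /i; field; rewrite !gt_eqF.
pose z := penalty u a m t i.
have z0 x : z x <= 0 by exact: penalty_le0.
have zge x : x != a -> eta <= u x - m -> - (l / 4) <= z x.
  move=> xa hx; rewrite /z /penalty (negPf xa) lerN2.
  have eM : eta <= Num.max (u x - m) i by rewrite le_max hx.
  rewrite ler_pdivrMr; last exact: lt_le_trans eta0 eM.
  rewrite /t -mulrA (mulrC eta) mulrA ler_wpM2l // divr_ge0 // ltW //.
pose K := [set x | `|x - a| <= r].
pose F (p : V * V) := bil S (p.1 - p.2) (p.1 - p.2) + z p.1 + z p.2.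
have [|||[p q] [/= Kp Kq] maxF] := @usc_compact_max _ (V * V)%type F (K `*` K).
- by exists (x0, y0).
- by apply: compact_setX; exact: closed_ball_compact.
- move=> [x y] [/= Kx Ky] e e0.
  have e30 : 0 < e / 3 by rewrite divr_gt0.
  have zx := penalty_usc m t0 i0 (uc x Kx) e30.
  have zy := penalty_usc m t0 i0 (uc y Ky) e30.
  have B : \forall p \near (x, y),
     `|bil S (x - y) (x - y) - bil S (p.1 - p.2) (p.1 - p.2)| < e / 3.
    have c : (fun p : V * V => p.1 - p.2) @ (x, y) --> x - y.
      by apply: cvgB; [exact: cvg_fst|exact: cvg_snd].
    have H : bil S (t.1 - t.2) (t.1 - t.2) @[t --> (x, y)] --> bil S (x - y) (x - y).
      exact: (cvg_bil _ c c).
    by move/cvgrPdist_lt: H; apply.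
  have zx' : \forall p \near (x, y), z p.1 < z x + e / 3.
    exact: (@cvg_fst V V (nbhs x) (nbhs y) _ _ zx).
  have zy' : \forall p \near (x, y), z p.2 < z y + e / 3.
    exact: (@cvg_snd V V (nbhs x) (nbhs y) _ _ zy).
  near=> p => _; rewrite /F /=.
  have : z p.1 < z x + e / 3 by near: p.
  have : z p.2 < z y + e / 3 by near: p.
  have : `|bil S (x - y) (x - y) - bil S (p.1 - p.2) (p.1 - p.2)| < e / 3 by near: p.
  rewrite ltr_norml => /andP[+ _]; move: (bil _ _ _) (bil _ _ _) => b1 b2; lra.
have Fpos : 0 < F (p, q).
  apply: lt_le_trans (maxF (x0, y0) (conj x0r y0r)); rewrite /F /= -/l.
  have : - (l / 4) <= z x0 by apply: zge => //; rewrite ge_min lexx.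
  have : - (l / 4) <= z y0 by apply: zge => //; rewrite ge_min lexx orbT.
  lra.
rewrite /F /= in Fpos.
have Lsym x y : bil S (x - y) (x - y) = bil S (y - x) (y - x).
  by rewrite -opprB bilNl bilNr opprK.
have h1 : bil S (p - q) (X p) <= 0.
  apply: (@penalized_max_le0 X S u a r m t i) => //.
    by have := z0 q; move: Fpos; rewrite -/z; lra.
  move=> x Kx; have := maxF (x, q) (conj Kx Kq); rewrite /F /= -/z.
  by rewrite lerD2r.
have h2 : bil S (q - p) (X q) <= 0.
  apply: (@penalized_max_le0 X S u a r m t i) => //.
    by rewrite Lsym; have := z0 p; move: Fpos; rewrite -/z; lra.
  move=> x Kx; have := maxF (p, x) (conj Kp Kx); rewrite /F /= -/z.
  by rewrite Lsym (Lsym p q) -!addrA (addrC (z p)) (addrC (z p)) !addrA lerD2r.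
have pq : p != q.
  apply: contraTneq Fpos => ->; rewrite subrr bil0l add0r -leNgt.
  by rewrite -(addr0 0) lerD.
have := mono p q Kp Kq pq; rewrite bilBr subr_gt0 ltNge => /negP; apply.
by apply: le_trans h1 _; rewrite -opprB bilNl oppr_le0 in h2.
Unshelve. all: by end_near. Qed.

End SaddleMaximum.
(** * Difference quotients of a first integral *)

Section DifferenceQuotients.
Context {R : realType} {d : nat}.
Local Notation V := 'rV[R]_d.
Implicit Types (X : V -> V) (f : V -> R) (x y a c v : V) (S Q : 'M[R]_d).

Lemma diff_shift f c x : differentiable f (x + c) ->
  differentiable (fun u => f (u + c)) x /\
  forall v, 'd (fun u => f (u + c)) x v = 'd f (x + c) v.
Proof.
move=> df; have dsh : differentiable (fun u : V => u + c) x.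
  by apply: differentiableD.
split; first exact: (@differentiable_comp _ _ _ _ (fun u => u + c) f).
move=> v; have e1 := congr1 (fun F : V -> R => F v)
  (@diff_comp _ _ _ _ (fun u : V => u + c) f x dsh df).
apply: (etrans e1) => /=; congr ('d f _ _).
have did : differentiable (id : V -> V) x by [].
have dc : differentiable (cst c : V -> V) x by [].
have e2 := congr1 (fun F : V -> V => F v) (diffD did dc).
apply: (etrans e2) => /=.
have e3 := congr1 (fun F : V -> V => F v)
  (@diff_lin _ _ _ (idfun : {linear V -> V}) x (fun x => cvg_id)).
have e4 := congr1 (fun F : V -> V => F v) (diff_cst c x).
by rewrite -[RHS]addr0; congr (_ + _).
Qed.

(** Differentiable wherever [f] is, and close to [grad f] for small [h]. *)
Definition diff_quot f (h : R) x : V :=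
  \row_i (h^-1 * (f (x + h *: 'e_i) - f x)).

Lemma diff_quot_diff f h x v :
  differentiable f x -> (forall i, differentiable f (x + h *: 'e_i)) ->
  differentiable (diff_quot f h) x /\
  'd (diff_quot f h) x v =
    \row_i (h^-1 * ('d f (x + h *: 'e_i) v - 'd f x v)).
Proof.
move=> df dfh.
have dj i : differentiable (fun u => diff_quot f h u 0 i) x /\
    'd (fun u => diff_quot f h u 0 i) x v =
    h^-1 * ('d f (x + h *: 'e_i) v - 'd f x v).
  have -> : (fun u => diff_quot f h u 0 i) =
     h^-1 *: ((fun u => f (u + h *: 'e_i)) - f).
    by apply/funext => u; rewrite mxE.
  have [d1 e1] := diff_shift (dfh i).
  have d2 : differentiable ((fun u => f (u + h *: 'e_i)) - f) x by exact: differentiableB.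
  split; first exact: differentiableZ.
  have e2 := congr1 (fun F : V -> R => F v) (diffZ h^-1 d2).
  apply: (etrans e2) => /=; congr (_ * _).
  have e3 := congr1 (fun F : V -> R => F v) (diffB d1 df).
  exact: (etrans e3 (congr1 (fun s => s - 'd f x v) (e1 v))).
have dD : differentiable (diff_quot f h) x.
  have -> : diff_quot f h = \sum_i (fun u => diff_quot f h u 0 i *: ('e_i : V)).
    by apply/funext => u; rewrite fct_sumE -row_sum_delta.
  by apply: differentiable_sum => i; apply: differentiableZl; exact: (dj i).1.
split=> //; apply/rowP => i; rewrite [RHS]mxE -(dj i).2.
by rewrite (diff_coord v i dD).2.
Qed.

Lemma norm_delta_le (i : 'I_d) : `|'e_i : V| <= 1.
Proof.
by apply: norm_le_coord => // j; rewrite mxE eqxx /=; case: eqP; rewrite ?normr1 ?normr0.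
Qed.

Lemma near_shift_delta x1 (P : V -> Prop) : (\forall y \near x1, P y) ->
  \forall x \near x1 & h \near (0 : R)^'+,
    [/\ P x, 0 < h & forall i, P (x + h *: 'e_i)].
Proof.
move=> /near_normP[r r0 hP].
have r20 : 0 < r / 2 by rewrite divr_gt0.
have n1 : \forall x \near x1, `|x - x1| < r / 2 by apply/near_normP; exists (r / 2).
have n2 : \forall h \near (0 : R)^'+, 0 < h < r / 2.
  near=> h; apply/andP; split; first by near: h; exact: nbhs_right_gt.
  by near: h; apply: nbhs_right_lt.
exists ([set x | `|x - x1| < r / 2], [set h : R | 0 < h < r / 2]) => //=.
move=> [x h] /= [xr /andP[h0 hr]]; split=> // [|i]; apply: hP; first by lra.
rewrite addrAC; apply: le_lt_trans (ler_normD _ _) _.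
have : `|h *: ('e_i : V)| <= h.
  by rewrite normrZ gtr0_norm // ler_piMr ?norm_delta_le // ltW.
by move: `|h *: _| => n; lra.
Unshelve. all: by end_near. Qed.

Lemma diff_quot_cvg f x1 : C1_at f x1 ->
  diff_quot f z.2 z.1 @[z --> filter_prod (nbhs x1) (0 : R)^'+] --> grad f x1.
Proof.
move=> f1; apply/cvgrPdist_le => e e0.
have [r r0 hr] := C1_strict_scalar f1 e0.
have : \forall y \near x1, `|y - x1| < r by apply/near_normP; exists r.
move=> /near_shift_delta; apply: filterS => -[x h] /= [xr h0 xhr].
apply: norm_le_coord => [|i]; first exact: ltW.
have := hr x (x + h *: 'e_i) xr (xhr i).
have -> : x + h *: 'e_i - x = h *: ('e_i : V) by rewrite addrAC subrr add0r.
rewrite linearZ /= !mxE => H.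
rewrite distrC -(ler_pM2l h0) -{1}(gtr0_norm h0) -normrM.
rewrite mulrBr mulVKf ?gt_eqF //; apply: le_trans H _.
rewrite normrZ gtr0_norm // mulrCA ler_wpM2l ?(ltW h0) // ler_piMr ?(ltW e0) //.
by rewrite norm_delta_le.
Qed.

Lemma row_cvg (T : Type) (F : set_system T) (FF : Filter F) (g : T -> V) (l : V) :
  (forall i, g t 0 i @[t --> F] --> l 0 i) -> g @ F --> l.
Proof.
move=> h; apply/cvgrPdist_le => e e0.
have h' : F [set t | forall i, `|l 0 i - g t 0 i| <= e].
  apply: (@filter_forall _ _ (fun i t => `|l 0 i - g t 0 i| <= e) F _) => i.
  by have /cvgrPdist_le := h i; apply.
apply: filterS h' => t ht; apply: norm_le_coord => [|i]; first exact: ltW.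
by rewrite !mxE.
Qed.

(** The derivative along [X] of a difference quotient would involve [f] to second
    order, but the invariance of [f] at both [x] and [y] trades it for a
    difference of [X]. *)
Lemma invariant_diff_quot X f x y (h : R) :
  'd f x (X x) = 0 -> 'd f y (X y) = 0 ->
  h^-1 * ('d f y (X x) - 'd f x (X x)) =
  bil 1%:M (- (h^-1 *: (X y - X x))) (grad f y).
Proof.
move=> fx fy; have fy' : bil 1%:M (X y) (grad f y) = 0 by rewrite -diff_grad.
rewrite bilNl bilZl bilBl fy' sub0r mulrN opprK; congr (_ * _).
exact: (etrans (congr1 (fun s => 'd f y (X x) - s) fx)
               (etrans (subr0 _) (diff_grad f y (X x)))).
Qed.

(** The adjoint equation [p' = - DX^T p] for the gradient [p] of a first integral,
    in the sense of a limit over both the point and the step. *)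
Lemma diff_quot_along_cvg X f x1 : C1_at f x1 -> C1_at X x1 ->
  (\forall x \near x1, 'd f x (X x) = 0) ->
  'd (diff_quot f z.2) (z.1) (X z.1) @[z --> filter_prod (nbhs x1) (0 : R)^'+]
    --> - (grad f x1 *m ('J X x1)^T).
Proof.
move=> f1 X1 inv.
pose y (i : 'I_d) (z : V * R) := z.1 + z.2 *: ('e_i : V).
pose G (z : V * R) : V := \row_i bil 1%:M
  (- (z.2^-1 *: (X (y i z) - X z.1))) (grad f (y i z)).
have GE : \forall z \near filter_prod (nbhs x1) (0 : R)^'+,
    'd (diff_quot f z.2) (z.1) (X z.1) = G z.
  have h : \forall x \near x1, differentiable f x /\ 'd f x (X x) = 0.
    by near=> x; split; near: x => //; exact: f1.1.
  apply: filterS (near_shift_delta h) => -[x t] /= [[dfx fx] t0 hx].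
  have [_ ->] := @diff_quot_diff f t x (X x) dfx (fun i => (hx i).1).
  by apply/rowP => i; rewrite !mxE; exact: invariant_diff_quot fx (hx i).2.
suff : G z @[z --> filter_prod (nbhs x1) (0 : R)^'+] --> - (grad f x1 *m ('J X x1)^T).
  apply: cvg_trans; apply: near_eq_cvg.
  by apply: filterS GE => z ->.
apply: row_cvg => i.
have -> : (- (grad f x1 *m ('J X x1)^T)) 0 i =
    bil 1%:M (- ('e_i *m 'J X x1)) (grad f x1).
  rewrite bilNl -rowE mxE; congr (- _); rewrite dotE mxE.
  by apply: eq_bigr => k _; rewrite !mxE mulrC.
have cX : - (z.2^-1 *: (X (y i z) - X z.1)) @[z --> filter_prod (nbhs x1) (0 : R)^'+]
    --> - ('e_i *m 'J X x1).
  apply/cvgrPdist_le => e e0; have [r r0 hr] := C1_strict X1 e0.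
  have : \forall y \near x1, `|y - x1| < r by apply/near_normP; exists r.
  move=> /near_shift_delta; apply: filterS => -[x h] /= [xr h0 xhr].
  have := hr x (x + h *: 'e_i) xr (xhr i).
  have -> : x + h *: 'e_i - x = h *: ('e_i : V) by rewrite addrAC subrr add0r.
  rewrite -scalemxAl /y /= => H.
  rewrite -opprD normrN distrC.
  rewrite -(ler_pM2l h0) -{1}(gtr0_norm h0) -normrZ.
  rewrite scalerBr scalerA mulfV ?gt_eqF // scale1r; apply: le_trans H _.
  rewrite normrZ gtr0_norm // mulrCA ler_wpM2l ?(ltW h0) // ler_piMr ?(ltW e0) //.
  by rewrite norm_delta_le.
have cg : grad f (y i z) @[z --> filter_prod (nbhs x1) (0 : R)^'+] --> grad f x1.
  have /continuous_normP h := continuous_grad f1.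
  apply/cvgrPdist_le => e e0.
  apply: filterS (near_shift_delta (h e e0)) => -[x t] /= [_ _ hx].
  by rewrite distrC ltW //; exact: hx.
have -> : (fun z => G z 0 i) =
    (fun z => bil 1%:M (- (z.2^-1 *: (X (y i z) - X z.1))) (grad f (y i z))).
  by apply/funext => z; rewrite /G mxE.
exact: cvg_bil.
Unshelve. all: by end_near. Qed.

End DifferenceQuotients.
(** * Growth of quadratic forms in the gradient *)

Section GradientDecay.
Context {R : realType} {d : nat}.
Local Notation V := 'rV[R]_d.
Implicit Types (X : V -> V) (f : V -> R) (x y a v : V) (S Q : 'M[R]_d).

Lemma diff_bil_comp Q (F : V -> V) x v : Q^T = Q -> differentiable F x ->
  differentiable (fun u => bil Q (F u) (F u)) x /\
  'd (fun u => bil Q (F u) (F u)) x v = 2 * bil Q (F x) ('d F x v).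
Proof.
move=> hQ dF; pose q (u : V) := bil Q (u - 0) (u - 0).
have [dq eq] : differentiable q (F x) /\ forall w, 'd q (F x) w = 2 * bil Q (F x - 0) w.
  exact: diff_bil_self.
have -> : (fun u => bil Q (F u) (F u)) = q \o F.
  by apply/funext => u; rewrite /q /= subr0.
split; first exact: differentiable_comp.
have e1 := congr1 (fun G : V -> R => G v) (diff_comp dF dq).
apply: (etrans e1); apply: (etrans (eq _)); by rewrite subr0.
Qed.

Lemma dist_split (s t w e : R) :
  `|s - t| < e / 2 -> `|s - w| < e / 2 -> `|t - w| <= e.
Proof.
rewrite !ltr_norml ler_norml => /andP[A1 A2] /andP[A3 A4].
by apply/andP; split; lra.
Qed.

Lemma double_ge0 (s t e : R) : 0 <= s - e * t -> 0 <= 2 * s - e * (2 * t).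
Proof. lra. Qed.

(** The approximating functions are obtained by replacing [grad f] with difference
    quotients. Their convergence is locally uniform by compactness, and their
    derivative along [X] converges to twice the difference of the two sides of the
    assumed strict inequality, hence is nonnegative near [x0]. *)
Lemma incr_along_grad X f Q a x0 (r e : R) : Q^T = Q -> 0 < r ->
  (forall x, `|x - x0| < r -> C1_at f x) -> C1_at X x0 ->
  (forall x, `|x - x0| < r -> 'd f x (X x) = 0) ->
  e * bil 1%:M (x0 - a) (X x0) < - bil Q (grad f x0) (grad f x0 *m ('J X x0)^T) ->
  incr_along X (fun x => bil Q (grad f x) (grad f x) - e * sqn (x - a)) x0.
Proof.
move=> hQ r0 f1 X1 inv slope.
have x0r : `|x0 - x0| < r by rewrite subrr normr0.
have nr : \forall x \near x0, `|x - x0| < r by apply/near_normP; exists r.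
pose Fl : set_system (V * R) := filter_prod (nbhs x0) (0 : R)^'+.
pose D (z : V * R) : V := 'd (diff_quot f z.2) (z.1) (X z.1).
have cD : D z @[z --> Fl] --> - (grad f x0 *m ('J X x0)^T).
  by apply: diff_quot_along_cvg => //; [exact: f1|near=> x; apply: inv; near: x].
have cq : diff_quot f z.2 z.1 @[z --> Fl] --> grad f x0 by exact/diff_quot_cvg/f1.
have cW : bil Q (diff_quot f z.2 z.1) (D z) @[z --> Fl]
    --> bil Q (grad f x0) (- (grad f x0 *m ('J X x0)^T)) by exact: (cvg_bil _ cq cD).
have cB : bil (e *: 1%:M) (z.1 - a) (X z.1) @[z --> Fl]
    --> bil (e *: 1%:M) (x0 - a) (X x0).
  have c1 : z.1 @[z --> Fl] --> x0 by exact: cvg_fst.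
  have c2 : z.1 - a @[z --> Fl] --> x0 - a by apply: cvgB => //; exact: cvg_cst.
  have c3 : X z.1 @[z --> Fl] --> X x0.
    have Xc : {for x0, continuous X}.
      exact: (differentiable_continuous (nbhs_singleton X1.1)).
    by apply: (cvg_comp _ _ c1); exact: Xc.
  exact: (cvg_bil _ c2 c3).
pose l := - bil Q (grad f x0) (grad f x0 *m ('J X x0)^T) - e * bil 1%:M (x0 - a) (X x0).
have l20 : 0 < l / 2 by rewrite divr_gt0 // subr_gt0.
have H1 : \forall x \near x0 & h \near (0 : R)^'+,
    differentiable (diff_quot f h) x /\
    0 <= bil Q (diff_quot f h x) (D (x, h)) - e * bil 1%:M (x - a) (X x).
  have /cvgrPdist_lt/(_ _ l20) hW := cW; have /cvgrPdist_lt/(_ _ l20) hB := cB.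
  have hd : \forall x \near x0, differentiable f x by exact: (f1 x0 x0r).1.
  have hd' := near_shift_delta hd.
  apply: (@filterS3 _ Fl _ _ _ _ _ _ hd' hW hB) => -[x h] /= [dx h0 dxh].
  rewrite bilNr !bilZm !ltr_norml => /andP[_ h1] /andP[h2 _].
  split; first exact: (diff_quot_diff 0 dx dxh).1.
  move: h1 h2; rewrite /l; move: (bil Q _ (D _)) (e * bil _ (x - a) _).
  by move: (bil Q _ _) (e * bil _ _ _) => b1 b2 b3 b4; lra.
have [[U W] /= [Ux0 Wh] UW] := H1.
move: Ux0 => /near_normP[r1 r10 hU].
pose rho := Num.min r r1 / 2.
have m0 : 0 < Num.min r r1 by rewrite lt_min r0.
have rho0 : 0 < rho by rewrite divr_gt0.
have [rho_r rho_r1] : rho < r /\ rho < r1.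
  have : rho < Num.min r r1 by rewrite /rho; lra.
  by rewrite lt_min => /andP[].
exists rho => // eps eps0.
pose K := [set x | `|x - x0| <= rho].
have cK : compact K by exact: closed_ball_compact.
have H2 : \forall h \near (0 : R)^'+, K `<=` (fun x =>
    `|bil Q (diff_quot f h x) (diff_quot f h x) - bil Q (grad f x) (grad f x)| <= eps).
  move/compact_near_coveringP : cK; apply => x1 Kx1.
  have x1r : `|x1 - x0| < r by exact: le_lt_trans rho_r.
  have e20 : 0 < eps / 2 by rewrite divr_gt0.
  have c1 := diff_quot_cvg (f1 x1 x1r).
  have c2 : bil Q (diff_quot f z.2 z.1) (diff_quot f z.2 z.1)
      @[z --> filter_prod (nbhs x1) (0 : R)^'+] --> bil Q (grad f x1) (grad f x1).
    exact: (cvg_bil _ c1 c1).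
  have c3 : bil Q (grad f x) (grad f x) @[x --> x1] --> bil Q (grad f x1) (grad f x1).
    have c := continuous_grad (f1 x1 x1r); exact: (cvg_bil _ c c).
  have /cvgrPdist_lt/(_ _ e20) h2 := c2; have /cvgrPdist_lt/(_ _ e20) h3 := c3.
  have h3' : filter_prod (nbhs x1) (0 : R)^'+ (fun z =>
      `|bil Q (grad f x1) (grad f x1) - bil Q (grad f z.1) (grad f z.1)| < eps / 2).
    exact: (@cvg_fst V R (nbhs x1) (0 : R)^'+ _ _ h3).
  apply: (@filterS2 _ (filter_prod (nbhs x1) (0 : R)^'+) _ _ _ _ _ h2 h3') => -[x h] /=.
  exact: dist_split.
have [h [Wh' Kh]] : exists h, W h /\ K `<=` (fun x =>
    `|bil Q (diff_quot f h x) (diff_quot f h x) - bil Q (grad f x) (grad f x)| <= eps).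
  by apply: (@filter_ex _ (0 : R)^'+); exact: filterI.
exists ((fun x => bil Q (diff_quot f h x) (diff_quot f h x))
        - e *: (fun x => bil 1%:M (x - a) (x - a))) => x xrho.
have [dq slope_x] := UW (x, h) (conj (hU x (lt_trans xrho rho_r1)) Wh').
have [d1 e1] := diff_bil_comp (X x) hQ dq.
have [d2 e2] := @diff_bil_self _ _ 1%:M a x (trmx1 _ _).
have d3 : differentiable (e *: (fun x => bil 1%:M (x - a) (x - a))) x.
  exact: differentiableZ.
split; first exact: differentiableB.
- rewrite /= !fctE /= /GRing.scale /= /sqn opprB addrA subrK.
  by apply: Kh; exact: ltW.
have E1 := congr1 (fun G : V -> R => G (X x)) (diffB d1 d3).
have E2 := congr1 (fun G : V -> R => G (X x)) (diffZ e d2).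
have E3 := congr1 (fun s => e * s) (e2 (X x)).
have E := etrans E1 (congr2 (fun s t => s - t) e1 (etrans E2 E3)).
apply: (eq_ind_r (fun s => 0 <= s) _ E).
exact: double_ge0.
Unshelve. all: by end_near. Qed.


(** The saddle maximum principle for [bil Q p p - e * sqn (x - a)], where [p] is
    the gradient of [f]. Where this exceeds [m], so does [bil Q p p]; hence [p] is
    bounded below and the growth [c |p|^2] of [bil Q p p] along [X] beats the
    variation of the distance term, bounded by [e D rho^2]. *)
Lemma grad_decay_step X f a S Q (c r B D m rho : R) :
  S^T = S -> Q^T = Q -> 0 < c -> 0 < B -> 0 <= D ->
  X a = 0 ->
  (forall x, `|x - a| < r -> C1_at X x) ->
  (forall x, `|x - a| < r -> x != a -> C1_at f x) ->
  (forall x, `|x - a| < r -> x != a -> 'd f x (X x) = 0) ->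
  (forall x y, `|x - a| < r -> `|y - a| < r -> x != y ->
     0 < bil S (x - y) (X x - X y)) ->
  (exists w, 0 < bil S w w) ->
  (forall x p, `|x - a| < r -> c * sqn p <= - bil Q p (p *m ('J X x)^T)) ->
  (forall p, bil Q p p <= B * sqn p) ->
  (forall x, `|x - a| < r -> `|bil 1%:M (x - a) (X x)| <= D * `|x - a| ^+ 2) ->
  0 < rho < r ->
  forall e, 0 <= e -> e * (D * rho ^+ 2) < c * (m / B) -> 0 <= m ->
  (forall x, `|x - a| = rho -> bil Q (grad f x) (grad f x) <= m + e * rho ^+ 2) ->
  forall x, `|x - a| <= rho -> x != a ->
    bil Q (grad f x) (grad f x) <= m + e * sqn (x - a).
Proof.
move=> hS hQ c0 B0 D0 Xa X1 f1 inv mono wS hc hB hD /andP[rho0 rho_r] e e0 em m0 sph.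
pose u x := bil Q (grad f x) (grad f x) - e * sqn (x - a).
have rr x : `|x - a| <= rho -> `|x - a| < r by move=> h; exact: le_lt_trans rho_r.
suff H x : `|x - a| <= rho -> x != a -> u x <= m.
  by move=> x xr xa; have := H x xr xa; rewrite /u lerBlDr.
apply: (@saddle_maximum_principle _ _ X S u a rho m hS Xa) => //.
- by move=> {}x /rr/X1[dX _]; exact: (differentiable_continuous (nbhs_singleton dX)).
- by move=> {}x y /rr xr /rr yr; exact: mono.
- move=> {}x /rr xr xa; have g := continuous_grad (f1 x xr xa).
  have c1 : {for x, continuous (fun x => bil Q (grad f x) (grad f x))}.
    exact: (cvg_bil _ g g).
  have [d2 _] := @diff_bil_self _ _ 1%:M a x (trmx1 _ _).
  have c2 := differentiable_continuous (differentiableZ e d2).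
  exact: (cvgB c1 c2).
- move=> {}x xrho; rewrite /u lerBlDr; apply: le_trans (sph x xrho) _.
  by rewrite lerD2l ler_wpM2l // -xrho sqr_norm_le_sqn.
move=> {}x xrho xa mu; have xr := lt_trans xrho rho_r.
have npos : 0 < `|x - a| by rewrite normr_gt0 subr_eq0.
have [s [s0 sr sa]] : exists s : R, [/\ 0 < s,
    forall y, `|y - x| < s -> `|y - a| < r & forall y, `|y - x| < s -> y != a].
  have h1 := near_norm_ball xr; have h2 := near_norm_neq xa.
  have /near_normP[s s0 hs] : \forall y \near x, `|y - a| < r /\ y != a.
    by near=> y; split; near: y.
  by exists s; split=> // y /hs[].
apply: (incr_along_grad (r := s)) => //.
- by move=> y ys; apply: f1; [exact: sr|exact: sa].
- exact: X1.
- by move=> y ys; apply: inv; [exact: sr|exact: sa].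
apply: lt_le_trans (hc x (grad f x) xr).
have b1 : bil 1%:M (x - a) (X x) <= D * rho ^+ 2.
  apply: le_trans (ler_norm _) _; apply: le_trans (hD x xr) _.
  by rewrite ler_wpM2l // ler_sqr ?nnegrE // ltW.
apply: le_lt_trans (ler_wpM2l e0 b1) _; apply: lt_le_trans em _.
rewrite ler_wpM2l ?(ltW c0) // ler_pdivrMr // mulrC.
apply: le_trans (hB _); apply: ltW; apply: lt_le_trans mu _.
by rewrite /u lerBlDr lerDl mulr_ge0 // sqn_ge0.
Unshelve. all: by end_near. Qed.

End GradientDecay.
(** * Limit of the gradient at a saddle *)

Section GradientLimit.
Context {R : realType} {d : nat}.
Local Notation V := 'rV[R]_d.
Implicit Types (X : V -> V) (f : V -> R) (x y a v : V) (S Q : 'M[R]_d).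

Lemma sqn_le_norm x : sqn x <= mxbound (1%:M : 'M[R]_d) * `|x| ^+ 2.
Proof.
by rewrite expr2 mulrA; apply: le_trans (ler_norm _) _; exact: bil_le.
Qed.

(** Bounds uniform over the sphere follow by covering the closed ball, the
    condition being void near points off the sphere. *)
Lemma sphere_bounded (N : V -> R) a (r : R) : 0 < r ->
  (forall x, `|x - a| = r -> {for x, continuous N}) ->
  exists2 m : R, 0 < m & forall x, `|x - a| = r -> N x <= m.
Proof.
move=> r0 Nc; pose K := [set x | `|x - a| <= r].
have : \forall m \near +oo, K `<=` (fun x => `|x - a| = r -> N x <= m).
  have /compact_near_coveringP : compact K by exact: closed_ball_compact.
  apply=> x Kx; have [xr|xr] := eqVneq `|x - a| r.
    have /continuous_normP/(_ _ ltr01) h := Nc x xr.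
    exists ([set y | `|N y - N x| < 1], [set m | N x + 1 < m]) => /=.
      by split=> //; apply: nbhs_pinfty_gt; exact: num_real.
    by move=> [y m] /= [+ hm _]; rewrite ltr_norml => /andP[_]; lra.
  have h : \forall y \near x, `|y - a| < r by apply: near_norm_ball; rewrite lt_neqAle xr.
  exists ([set y | `|y - a| < r], setT) => /=; first by split=> //; exact: filterT.
  by move=> [y m] /= [+ _ e]; rewrite e ltxx.
have p1 : \forall m \near +oo, 0 < (m : R) by apply: nbhs_pinfty_gt; exact: num_real.
move=> hK; have [m [m0 hm]] := filter_ex (filterI p1 hK).
by exists m => // x xr; apply: hm => //; rewrite /K /= xr.
Qed.

(** With [e = 0], [grad_decay_step] bounds [bil Q p p] on a punctured ball by its
    maximum on a sphere. With [e > 0], a bound [m] on the ball of radius [rho]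
    improves to [q m] on a smaller ball, for a ratio [q < 1] that depends neither
    on [m] nor on [rho], and the bound is iterated. *)
Lemma grad_limsup X f a S Q (c r B D : R) :
  S^T = S -> Q^T = Q -> 0 < c -> 0 < B -> 0 <= D -> 0 < r ->
  X a = 0 ->
  (forall x, `|x - a| < r -> C1_at X x) ->
  (forall x, `|x - a| < r -> x != a -> C1_at f x) ->
  (forall x, `|x - a| < r -> x != a -> 'd f x (X x) = 0) ->
  (forall x y, `|x - a| < r -> `|y - a| < r -> x != y ->
     0 < bil S (x - y) (X x - X y)) ->
  (exists w, 0 < bil S w w) ->
  (forall x p, `|x - a| < r -> c * sqn p <= - bil Q p (p *m ('J X x)^T)) ->
  (forall p, bil Q p p <= B * sqn p) ->
  (forall x, `|x - a| < r -> `|bil 1%:M (x - a) (X x)| <= D * `|x - a| ^+ 2) ->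
  forall e : R, 0 < e -> exists2 rho : R, 0 < rho &
    forall x, `|x - a| < rho -> x != a -> bil Q (grad f x) (grad f x) <= e.
Proof.
move=> hS hQ c0 B0 D0 r0 Xa X1 f1 inv mono wS hc hB hD.
pose N x := bil Q (grad f x) (grad f x).
have step := grad_decay_step hS hQ c0 B0 D0 Xa X1 f1 inv mono wS hc hB hD.
have r2r : 0 < r / 2 < r by clear -r0; lra.
have [m0 m00 hm0] : exists2 m : R, 0 < m & forall x, `|x - a| = r / 2 -> N x <= m.
  apply: sphere_bounded => [|x xr]; first by case/andP: r2r.
  have xr' : `|x - a| < r by rewrite xr; case/andP: r2r.
  have xa : x != a.
    by apply: contraTneq r0 => xa; rewrite -leNgt; move: xr; rewrite xa subrr normr0; clear; lra.
  by have g := continuous_grad (f1 x xr' xa); exact: (cvg_bil _ g g).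
have N0 x : `|x - a| <= r / 2 -> x != a -> N x <= m0.
  move=> xr xa; have := step m0 _ r2r 0 (lexx 0).
  rewrite !mul0r => /(_ _ (ltW m00) _ x xr xa); rewrite mul0r addr0; apply.
    by rewrite mulr_gt0 // divr_gt0.
  by move=> y yr; rewrite ?mul0r ?addr0; exact: hm0.
(* The step is applied with the level [(1 - th) m] and [e = th m / rho^2], so that
   both agree with the bound [m] on the sphere of radius [rho]; [th] is small
   enough for the growth condition of the step. *)
pose th := Num.min 2^-1 (c / (2 * B * (D + 1))).
have th0 : 0 < th.
  by rewrite lt_min invr_gt0 ltr0n divr_gt0 // mulr_gt0 ?mulr_gt0 // ltr_wpDl.
have th2 : th <= 2^-1 by rewrite ge_min lexx.
have thD : th * D < c / (2 * B).
  apply: (@lt_le_trans _ _ (th * (D + 1))); first by rewrite ltr_pM2l // ltrDl.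
  rewrite -ler_pdivlMr ?ltr_wpDl // -[leRHS]mulrA -invfM.
  by rewrite ge_min lexx orbT.
pose q := 1 - th / 2.
pose M := mxbound (1%:M : 'M[R]_d).
have M0 : 0 <= M by exact: mxbound_ge0.
have contr m rho : 0 < m -> 0 < rho < r ->
    (forall x, `|x - a| <= rho -> x != a -> N x <= m) ->
    exists2 rho', 0 < rho' < r & forall x, `|x - a| <= rho' -> x != a -> N x <= q * m.
  move=> m1 rho_r hN; have /andP[rho0 rhor] := rho_r.
  (* On the ball of radius [s] the distance term is at most [th m / 4]. *)
  pose s := rho / (2 * (M + 1)).
  have M2 : 0 < 2 * (M + 1) by rewrite mulr_gt0 // ltr_wpDl.
  have s0 : 0 < s by rewrite divr_gt0.
  have srho : s <= rho.
    by rewrite ler_pdivrMr // ler_peMr ?(ltW rho0) //; clear -M0; lra.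
  have rho2 : 0 < rho ^+ 2 by rewrite exprn_gt0.
  exists s; first by rewrite s0 (le_lt_trans srho).
  move=> x xs xa; pose e := th * m / rho ^+ 2.
  have e0 : 0 <= e by rewrite divr_ge0 ?mulr_ge0 // ltW.
  have hstep : N x <= (1 - th) * m + e * sqn (x - a).
    apply: (step _ _ rho_r e e0) => //.
    - have -> : e * (D * rho ^+ 2) = (th * D) * m.
        by rewrite /e; field; rewrite gt_eqF.
      apply: (@lt_le_trans _ _ (c / (2 * B) * m)); first by rewrite ltr_pM2r.
      have -> : c / (2 * B) * m = c * (m / 2 / B) by field; rewrite gt_eqF.
      rewrite ler_wpM2l ?(ltW c0) // ler_wpM2r ?invr_ge0 ?(ltW B0) //.
      rewrite mulrC ler_wpM2r ?(ltW m1) //; by clear -th2; lra.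
    - by rewrite mulr_ge0 ?(ltW m1) //; clear -th2; lra.
    - move=> y yrho; have -> : (1 - th) * m + e * rho ^+ 2 = m.
        by rewrite /e; field; rewrite gt_eqF.
      apply: hN; first by rewrite yrho.
      by apply: contraTneq rho0 => ya; rewrite -yrho ya subrr normr0 ltxx.
    - exact: le_trans srho.
  apply: le_trans hstep _.
  have hs : e * sqn (x - a) <= th * m / 4.
    apply: (@le_trans _ _ (e * (M * s ^+ 2))).
      rewrite ler_wpM2l //; apply: le_trans (sqn_le_norm _) _.
      by rewrite ler_wpM2l // lerXn2r ?nnegrE // ltW.
    have -> : e * (M * s ^+ 2) = th * m / 4 * (M / (M + 1) ^+ 2).
      by rewrite /e /s; field; rewrite !gt_eqF // ltr_wpDl.
    rewrite ler_piMr ?divr_ge0 ?mulr_ge0 ?(ltW th0) ?(ltW m1) //.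
    rewrite ler_pdivrMr ?exprn_gt0 ?ltr_wpDl // mul1r.
    by move: M0; clear; move: M => M M0; have := sqr_ge0 M; rewrite expr2; nra.
  have tm : 0 <= th * m by rewrite mulr_ge0 // ltW.
  by rewrite /q; move: hs tm; clear; move: (e * _) => z; lra.
have q0 : 0 < q by rewrite /q; clear -th2; lra.
have q1 : q < 1 by rewrite /q; clear -th0; lra.
have iterN n : exists2 rho, 0 < rho < r &
    forall x, `|x - a| <= rho -> x != a -> N x <= q ^+ n * m0.
  elim: n => [|n [rho rho_r hN]]; first by exists (r / 2) => // x; rewrite mul1r; exact: N0.
  have [|rho' rho'_r hN'] := contr (q ^+ n * m0) rho _ rho_r hN.
    by rewrite mulr_gt0 // exprn_gt0.
  by exists rho' => // x xr xa; rewrite exprS -mulrA; exact: hN'.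
move=> e e0.
have [n hn] : exists n, q ^+ n * m0 <= e.
  have em0 : 0 < e / m0 by rewrite divr_gt0.
  have qn : `|q| < 1 by rewrite gtr0_norm.
  have /cvgrPdist_lt/(_ _ em0) := cvg_expr qn.
  move=> /filter_ex[n]; rewrite sub0r normrN normrX gtr0_norm // => h.
  by exists n; rewrite -ler_pdivlMr // ltW.
have [rho /andP[rho0 _] hN] := iterN n.
by exists rho => // x xr xa; apply: le_trans hn; apply: hN => //; exact: ltW.
Qed.

End GradientLimit.
(** * Perturbing the linear part *)

Section LocalExtension.
Context {R : realType} {d : nat}.
Local Notation V := 'rV[R]_d.
Implicit Types (X : V -> V) (f : V -> R) (x y a v w p : V) (S Q A : 'M[R]_d).

Lemma C1_opp X x : C1_at X x -> C1_at (fun u => - X u) x.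
Proof.
move=> [dX cX]; split.
  by apply: filterS dX => u dXu; exact: differentiableN.
move=> v; apply/continuous_normP => e e0.
have /continuous_normP/(_ e e0) h := cX v; have dx := nbhs_singleton dX.
apply: filterS2 (dX) h => u dXu.
have e1 := congr1 (fun F : V -> V => F v) (diffN dXu).
have e2 := congr1 (fun F : V -> V => F v) (diffN dx).
have E := congr2 (fun s t : V => s - t) e1 e2.
move=> h; apply: (eq_ind_r (fun s : V => `|s| < e) _ E).
by rewrite /= -opprD normrN.
Qed.

Lemma jacobian_opp X x : differentiable X x -> 'J (fun u => - X u) x = - 'J X x.
Proof.
move=> dX; apply/row_matrixP => i; rewrite !rowE -diff_jacobian.
have e1 := congr1 (fun F : V -> V => F 'e_i) (diffN dX).
by apply: (etrans e1); rewrite mulmxN; congr (- _); exact: diff_jacobian.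
Qed.

Lemma near_jacobian X a (e : R) : C1_at X a -> 0 < e ->
  \forall x \near a, mxbound (('J X x - 'J X a)^T) <= e.
Proof.
move=> [_ cX] e0; pose e1 := e / (d%:R ^+ 2 + 1).
have d1 : 0 < (d%:R : R) ^+ 2 + 1 by rewrite ltr_wpDl // sqr_ge0.
have e10 : 0 < e1 by rewrite divr_gt0.
have h : \forall x \near a, forall i, `|'d X x 'e_i - 'd X a 'e_i| < e1.
  apply: (@filter_forall _ _ (fun i u => `|'d X u 'e_i - 'd X a 'e_i| < e1) (nbhs a) _) => i.
  by have /continuous_normP := cX 'e_i; apply.
apply: filterS h => x hx; apply: (@le_trans _ _ (\sum_(j < d) \sum_(i < d) e1)).
  apply: ler_sum => j _; apply: ler_sum => i _.
  have := coord_norm_le ('d X x 'e_i - 'd X a 'e_i) j.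
  have E : ('d X x 'e_i - 'd X a 'e_i) 0 j = ('J X x - 'J X a)^T j i.
    by rewrite [RHS]mxE /jacobian !mxE.
  by rewrite E => /le_trans; apply; apply: ltW.
rewrite !sumr_const !card_ord -mulrnA -mulr_natr natrM -expr2 /e1.
by rewrite mulrAC ler_pdivrMr // ler_wpM2l ?(ltW e0) // lerDl.
Qed.

Lemma bil_mulr Q p A : bil Q p (p *m A^T) = bil (Q *m A) p p.
Proof. by rewrite /bil trmx_mul trmxK !mulmxA. Qed.

(** A coercive bound survives, with half the constant, a perturbation of the vector
    that is small relative to [w]. *)
Lemma bil_perturbation S (c t : R) w z : 0 < c ->
  `|z| <= c / (2 * (mxbound S + 1)) * `|w| -> c * sqn w <= t ->
  c / 2 * sqn w <= t + bil S w z.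
Proof.
move=> c0 zw hw; have M0 : 0 < mxbound S + 1 by rewrite ltr_wpDl ?mxbound_ge0.
have : `|bil S w z| <= c / 2 * sqn w.
  apply: le_trans (bil_le _ _ _) _.
  apply: (@le_trans _ _ ((mxbound S + 1) * `|w| * (c / (2 * (mxbound S + 1)) * `|w|))).
    by apply: ler_pM => //; [rewrite mulr_ge0 ?mxbound_ge0|rewrite ler_wpM2r // lerDl].
  have -> : (mxbound S + 1) * `|w| * (c / (2 * (mxbound S + 1)) * `|w|)
      = c / 2 * `|w| ^+ 2 by field; rewrite gt_eqF.
  by rewrite ler_wpM2l ?sqr_norm_le_sqn // divr_ge0 // ltW.
rewrite ler_norml => /andP[+ _]; move: hw; clear.
by move: (bil _ _ _) (sqn w) => b s; lra.
Qed.

(** Strict differentiability at [a] transfers the Lyapunov inequality of the linear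
    part to differences of the field. *)
Lemma hyperbolic_monotone X a S (c : R) : C1_at X a -> 0 < c ->
  (forall w, c * sqn w <= bil S w (w *m 'J X a)) ->
  exists2 r : R, 0 < r & forall x y, `|x - a| < r -> `|y - a| < r ->
    c / 2 * sqn (x - y) <= bil S (x - y) (X x - X y).
Proof.
move=> X1 c0 hS.
have e0 : 0 < c / (2 * (mxbound S + 1)).
  by rewrite divr_gt0 // mulr_gt0 // ltr_wpDl ?mxbound_ge0.
have [r r0 hr] := C1_strict X1 e0; exists r => // x y xr yr.
have := bil_perturbation c0 (hr y x yr xr) (hS (x - y)).
by rewrite -bilDr [X in bil _ _ X]addrC subrK.
Qed.

(** The adjoint counterpart of [hyperbolic_monotone], by continuity of the Jacobian. *)
Lemma hyperbolic_coercive X a Q (c : R) : C1_at X a -> 0 < c ->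
  (forall p, c * sqn p <= - bil Q p (p *m ('J X a)^T)) ->
  exists2 r : R, 0 < r & forall x p, `|x - a| < r ->
    c / 2 * sqn p <= - bil Q p (p *m ('J X x)^T).
Proof.
move=> X1 c0 hQ.
have e0 : 0 < c / (2 * (mxbound Q + 1)).
  by rewrite divr_gt0 // mulr_gt0 // ltr_wpDl ?mxbound_ge0.
have /near_normP[r r0 hr] := near_jacobian X1 e0; exists r => // x p xr.
have small : `|- (p *m ('J X x - 'J X a)^T)| <= c / (2 * (mxbound Q + 1)) * `|p|.
  by rewrite normrN; apply: le_trans (normM_le _ _) _; rewrite ler_wpM2r // hr.
have := bil_perturbation c0 small (hQ p).
by rewrite bilNr -opprD -bilDr -mulmxDr linearB /= [X in p *m X]addrC subrK.
Qed.

Lemma linear_growth X a : C1_at X a -> X a = 0 ->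
  exists2 D : R, 0 <= D & exists2 r : R, 0 < r &
    forall x, `|x - a| < r -> `|bil 1%:M (x - a) (X x)| <= D * `|x - a| ^+ 2.
Proof.
move=> X1 Xa; have [r r0 hr] := C1_strict X1 ltr01.
have D0 : 0 <= mxbound (1%:M : 'M[R]_d) * (mxbound ('J X a) + 1).
  by rewrite mulr_ge0 ?addr_ge0 ?mxbound_ge0.
exists (mxbound (1%:M : 'M[R]_d) * (mxbound ('J X a) + 1)) => //; exists r => // x xr.
have := hr a x; rewrite subrr normr0 Xa subr0 mul1r => /(_ r0 xr) h.
apply: le_trans (bil_le _ _ _) _.
have : `|X x| <= (mxbound ('J X a) + 1) * `|x - a|.
  rewrite -[X x](subrK ((x - a) *m 'J X a)) mulrDl mul1r addrC.
  by apply: le_trans (ler_normD _ _) _; apply: lerD => //; exact: normM_le.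
move=> hX; have -> : mxbound (1%:M : 'M[R]_d) * (mxbound ('J X a) + 1) * `|x - a| ^+ 2
  = mxbound (1%:M : 'M[R]_d) * `|x - a| * ((mxbound ('J X a) + 1) * `|x - a|) by ring.
by rewrite ler_wpM2l // mulr_ge0 ?mxbound_ge0.
Qed.

Lemma grad_limsup_at X f a S Q (c c' r : R) :
  S^T = S -> Q^T = Q -> 0 < c -> 0 < c' -> 0 < r -> X a = 0 ->
  (forall x, `|x - a| < r -> C1_at X x) ->
  (forall x, `|x - a| < r -> x != a -> C1_at f x) ->
  (forall x, `|x - a| < r -> x != a -> 'd f x (X x) = 0) ->
  (forall w, c * sqn w <= bil S w (w *m 'J X a)) ->
  (exists w, 0 < bil S w w) ->
  (forall p, c' * sqn p <= - bil Q p (p *m ('J X a)^T)) ->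
  forall e : R, 0 < e -> exists2 rho : R, 0 < rho &
    forall x, `|x - a| < rho -> x != a -> bil Q (grad f x) (grad f x) <= e.
Proof.
move=> hS hQ c0 c0' r0 Xa X1 f1 inv hyp wS coer.
have X1a : C1_at X a by apply: X1; rewrite subrr normr0.
have [r1 r10 h1] := hyperbolic_monotone X1a c0 hyp.
have [r2 r20 h2] := hyperbolic_coercive X1a c0' coer.
have [D D0 [r3 r30 h3]] := linear_growth X1a Xa.
pose s := Num.min (Num.min r r1) (Num.min r2 r3).
have s0 : 0 < s by rewrite !lt_min r0 r10 r20 r30.
have ss x : `|x - a| < s -> [/\ `|x - a| < r, `|x - a| < r1, `|x - a| < r2 & `|x - a| < r3].
  by rewrite !lt_min => /andP[/andP[? ?] /andP[? ?]].
apply: (@grad_limsup _ _ X f a S Q (c' / 2) s (mxbound Q + 1) D hS hQ _ _ D0 s0 Xa).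
- by rewrite divr_gt0.
- by rewrite ltr_wpDl ?mxbound_ge0.
- by move=> x /ss[xr _ _ _]; exact: X1.
- by move=> x /ss[xr _ _ _]; exact: f1.
- by move=> x /ss[xr _ _ _]; exact: inv.
- move=> x y /ss[_ xr _ _] /ss[_ yr _ _] xy; apply: lt_le_trans (h1 x y xr yr).
  by rewrite mulr_gt0 ?divr_gt0 // sqn_gt0 // subr_eq0.
- exact: wS.
- by move=> x p /ss[_ _ xr _]; exact: h2.
- move=> p; apply: le_trans (ler_norm _) _; apply: le_trans (bil_le_sqn _ _) _.
  by rewrite ler_wpM2r ?sqn_ge0 // lerDl.
- by move=> x /ss[_ _ _ xr]; exact: h3.
Qed.

(** The forms [- K + eta] and [K + eta] grow along [X] and [- X] respectively for
    [eta] small, and [- S] is a Lyapunov form of [- X]. The two upper limits add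
    up to [2 eta] times that of [sqn p]. Both a positive and a negative direction
    of [S] are required, one for each sense of time. *)
Theorem saddle_grad_cvg0 X f a S K (c c' r : R) :
  S^T = S -> K^T = K -> 0 < c -> 0 < c' -> 0 < r -> X a = 0 ->
  (forall x, `|x - a| < r -> C1_at X x) ->
  (forall x, `|x - a| < r -> x != a -> C1_at f x) ->
  (forall x, `|x - a| < r -> x != a -> 'd f x (X x) = 0) ->
  (forall w, c * sqn w <= bil S w (w *m 'J X a)) ->
  (forall p, c' * sqn p <= bil K p (p *m ('J X a)^T)) ->
  (exists w, 0 < bil S w w) -> (exists w, bil S w w < 0) ->
  forall e : R, 0 < e -> exists2 rho : R, 0 < rho &
    forall x, `|x - a| < rho -> x != a -> `|grad f x| <= e.
Proof.
move=> hS hK c0 c0' r0 Xa X1 f1 inv hypS hypK wS [w0 w0S] e e0.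
have X1a : C1_at X a by apply: X1; rewrite subrr normr0.
have dXa := nbhs_singleton X1a.1.
pose M := mxbound ('J X a) + 1.
have M0 : 0 < M by rewrite ltr_wpDl ?mxbound_ge0.
(* Then [eta] times the form of the Jacobian is at most half of [c' * sqn p]. *)
pose eta := c' / (2 * M); have eta0 : 0 < eta by rewrite divr_gt0 // mulr_gt0.
have hid p : `|eta * bil 1%:M p (p *m ('J X a)^T)| <= c' / 2 * sqn p.
  rewrite bil_mulr mul1mx normrM (gtr0_norm eta0).
  apply: (@le_trans _ _ (eta * (M * sqn p))).
    rewrite ler_wpM2l ?(ltW eta0) //; apply: le_trans (bil_le_sqn _ _) _.
    by rewrite ler_wpM2r ?sqn_ge0 // lerDl.
  by rewrite le_eqVlt /eta; apply/orP; left; apply/eqP; field; rewrite gt_eqF.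
have c20 : 0 < c' / 2 by rewrite divr_gt0.
have T1 : (eta *: 1%:M : 'M[R]_d)^T = eta *: 1%:M by rewrite linearZ /= trmx1.
have ee0 : 0 < eta * e ^+ 2 by rewrite mulr_gt0 // exprn_gt0.
have [r1 r10 h1] : exists2 rho : R, 0 < rho & forall x, `|x - a| < rho -> x != a ->
    bil (- K + eta *: 1%:M) (grad f x) (grad f x) <= eta * e ^+ 2.
  have T2 : (- K + eta *: 1%:M)^T = - K + eta *: 1%:M by rewrite linearD linearN /= hK T1.
  apply: (grad_limsup_at hS T2 c0 c20 r0 Xa X1 f1 inv hypS wS _ ee0).
  move=> p; rewrite bilDm bilNm bilZm; have := hypK p; have := hid p.
  rewrite ler_norml => /andP[_]; clear.
  by move: (bil K _ _) (eta * _) (sqn p) => b1 b2 s; lra.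
have [r2 r20 h2] : exists2 rho : R, 0 < rho & forall x, `|x - a| < rho -> x != a ->
    bil (K + eta *: 1%:M) (grad f x) (grad f x) <= eta * e ^+ 2.
  have T2 : (K + eta *: 1%:M)^T = K + eta *: 1%:M by rewrite linearD /= hK T1.
  have S2 : (- S)^T = - S by rewrite linearN /= hS.
  have Xa2 : - X a = 0 by rewrite Xa oppr0.
  apply: (@grad_limsup_at (fun x => - X x) f a (- S) (K + eta *: 1%:M) c (c' / 2) r
            S2 T2 c0 c20 r0 Xa2 _ f1 _ _ _ _ _ ee0).
  - by move=> x /X1; exact: C1_opp.
  - by move=> x xr xa; rewrite linearN /= (inv x xr xa) oppr0.
  - by move=> w; rewrite (jacobian_opp dXa) mulmxN bilNm bilNr opprK.
  - by exists w0; rewrite bilNm oppr_gt0.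
  move=> p; rewrite (jacobian_opp dXa) linearN /= mulmxN bilNr opprK bilDm bilZm.
  have := hypK p; have := hid p.
  rewrite ler_norml => /andP[+ _]; clear.
  by move: (bil K _ _) (eta * _) (sqn p) => b1 b2 s; lra.
exists (Num.min r1 r2); first by rewrite lt_min r10.
move=> x; rewrite lt_min => /andP[xr1 xr2] xa.
have := lerD (h1 x xr1 xa) (h2 x xr2 xa).
rewrite -bilDm addrACA addNr add0r -scalerDl bilZm -/(sqn _) -[X in _ <= X]mulrDl.
rewrite -(ler_sqr (normr_ge0 _) (ltW e0)) => h.
apply: le_trans (sqr_norm_le_sqn _) _; move: h.
by rewrite ler_pM2l // addr_gt0.
Qed.

End LocalExtension.
(** * Sinks, sources and the C1 extension *)

Section DefiniteCase.
Context {R : realType} {d : nat}.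
Local Notation V := 'rV[R]_d.
Implicit Types (X : V -> V) (f : V -> R) (x y a v w p : V) (S Q A : 'M[R]_d).

(** Evaluate the nonpositive form at [w + t (w A)]: its first-order term is
    [2 t bil S w (w A)], at least [2 t c sqn w], and for [t] small it dominates
    the second-order term, which forces [bil S w w] to be at most a negative
    multiple of [sqn w]. *)
Lemma semidefinite_definite S A (c : R) : S^T = S -> 0 < c ->
  (forall w, c * sqn w <= bil S w (w *m A)) -> (forall w, bil S w w <= 0) ->
  exists2 k : R, 0 < k & forall w, k * sqn w <= - bil S w w.
Proof.
move=> hS c0 hA neg; pose C := mxbound S * mxbound A ^+ 2 + 1.
have C0 : 0 < C by rewrite ltr_wpDl // mulr_ge0 ?mxbound_ge0 // sqr_ge0.
pose t := c / C; have t0 : 0 < t by rewrite divr_gt0.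
exists (t * c); first by rewrite mulr_gt0.
move=> w; have := neg (w + t *: (w *m A)).
rewrite !(bilDl, bilDr, bilZl, bilZr) (bilC (w *m A) w hS).
have h1 : `|bil S (w *m A) (w *m A)| <= C * sqn w.
  apply: le_trans (bil_le _ _ _) _; rewrite -mulrA -expr2.
  have hw : `|w *m A| ^+ 2 <= (mxbound A * `|w|) ^+ 2.
    by rewrite lerXn2r ?nnegrE ?mulr_ge0 ?mxbound_ge0 // normM_le.
  apply: le_trans (ler_wpM2l (mxbound_ge0 S) hw) _.
  rewrite exprMn mulrA; apply: ler_pM; rewrite ?mulr_ge0 ?mxbound_ge0 ?sqr_ge0 //.
    by rewrite lerDl.
  exact: sqr_norm_le_sqn.
have := hA w; move: h1; rewrite ler_norml => /andP[h1 _].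
have tC : t * C = c by rewrite /t mulfVK // gt_eqF.
have q0 := sqn_ge0 w.
have h2 := ler_wpM2l (ltW (mulr_gt0 t0 t0)) h1.
move: (bil S (w *m A) _) (bil S w (w *m A)) (bil S w w) h2 q0 => b1 b2 b3.
move: (sqn w) => q h2 q0 h3.
have h4 := ler_wpM2l (ltW t0) h3.
have e : t * t * - (C * q) = - (t * (c * q)) by rewrite -tC; ring.
rewrite e in h2; move: h2 h4; rewrite -!mulrA; clear; lra.
Qed.

Lemma near_increase (g : V -> R) x v : differentiable g x -> 0 < 'd g x v ->
  \forall s \near (0 : R)^'+, g x < g (x + s *: v).
Proof.
move=> dg; move D_def : ('d g x v : R) => D D0.
have e0 : 0 < D / (2 * (`|v| + 1)) by rewrite divr_gt0 // mulr_gt0 // ltr_wpDl.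
have /near_normP[r r0 hr] := diff_norm dg e0.
have n1 : 0 < r / (`|v| + 1) by rewrite divr_gt0 // ltr_wpDl.
near=> s; have s0 : 0 < s by near: s; exact: nbhs_right_gt.
have sr : s < r / (`|v| + 1) by near: s; exact: nbhs_right_lt.
have := hr (x + s *: v).
have -> : x + s *: v - x = s *: v by rewrite addrAC subrr add0r.
rewrite linearZ /= D_def normrZ gtr0_norm // => /(_ _)/wrap[].
  apply: le_lt_trans (_ : s * (`|v| + 1) < r); last by rewrite -ltr_pdivlMr // ltr_wpDl.
  by rewrite ler_wpM2l ?(ltW s0) // lerDl.
have : D / (2 * (`|v| + 1)) * (s * `|v|) <= s * D / 2.
  have -> : D / (2 * (`|v| + 1)) * (s * `|v|) = s * D / 2 * (`|v| / (`|v| + 1)).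
    by field; rewrite gt_eqF // ltr_wpDl.
  rewrite ler_piMr ?divr_ge0 ?mulr_ge0 ?(ltW s0) ?(ltW D0) //.
  by rewrite ler_pdivrMr ?ltr_wpDl // mul1r lerDl.
move=> /[swap] /le_trans h /h {h}; rewrite ler_norml => /andP[+ _].
have := mulr_gt0 s0 D0; rewrite /GRing.scale /=; clear.
by move: (g x) (g _) => g1 g2; lra.
Unshelve. all: by end_near. Qed.

(** For every [e > 0], [f + e L] strictly increases along [X] off [a], and [X]
    points into the sublevel set [K] of [- L]; so its maximum over [K] can only be
    attained at [a]. Let [e] tend to [0]. *)
Lemma definite_upper_bound X f a S (c k r : R) : S^T = S -> 0 < c -> 0 < k -> 0 < r ->
  (forall x, `|x - a| < r -> c * sqn (x - a) <= bil S (x - a) (X x)) ->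
  (forall w, k * sqn w <= - bil S w w) ->
  {for a, continuous f} ->
  (forall x, `|x - a| < r -> x != a -> differentiable f x) ->
  (forall x, `|x - a| < r -> x != a -> 'd f x (X x) = 0) ->
  exists2 rho : R, 0 < rho & forall x, `|x - a| < rho -> f x <= f a.
Proof.
move=> hS c0 k0 r0 mono negS fa df inv.
pose L x := bil S (x - a) (x - a).
have dL x : differentiable L x /\ forall v, 'd L x v = 2 * bil S (x - a) v.
  exact: diff_bil_self.
(* This level confines the points of [K] to the ball of radius [r / 4], so that a
   short move along [X] stays in the ball of radius [r / 2]. *)
pose r1 := k * (r / 4) ^+ 2.
have r10 : 0 < r1 by rewrite mulr_gt0 // exprn_gt0 // divr_gt0.
pose K := [set x | `|x - a| <= r / 2] `&` [set x | - L x <= r1].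
have Kr x : - L x <= r1 -> `|x - a| <= r / 4.
  move=> h; rewrite -ler_sqr ?nnegrE ?divr_ge0 ?(ltW r0) // -(ler_pM2l k0).
  apply: le_trans h; apply: le_trans (negS _).
  by rewrite ler_pM2l // sqr_norm_le_sqn.
have cK : compact K.
  apply: compact_closedI; first exact: closed_ball_compact.
  have -> : [set x | - L x <= r1] = (- L) @^-1` [set t | t <= r1] by [].
  apply: closed_comp; last exact: closed_le.
  move=> x _; apply: differentiable_continuous.
  exact: (differentiableN (dL x).1).
have L0 : L a = 0 by rewrite /L subrr bil0l.
have Ka : K a.
  by split=> /=; [rewrite subrr normr0 divr_ge0 // ltW|rewrite L0 oppr0 ltW].
have fc x : `|x - a| < r -> {for x, continuous f}.
  by move=> xr; have [->//|xa] := eqVneq x a; exact/differentiable_continuous/df.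
have maxa e : 0 < e -> forall x, K x -> f x + e * L x <= f a.
  move=> e0; pose F : V -> R := f + e *: L.
  have [|||y + maxy] := @compact_EVT_max V R F K.
  - by exists a.
  - exact: cK.
  - apply: continuous_in_subspaceT => x; rewrite inE => -[/= xr _].
    have c2 := differentiable_continuous (differentiableZ e (dL x).1).
    by apply: (cvgD _ c2); apply: fc; clear -xr r0; lra.
  rewrite inE => -[/= yr yL].
  suff ya : y = a.
    move=> x Kx; have := maxy x; rewrite inE => /(_ Kx).
    by rewrite /F /= !fctE /= ya L0 scaler0 addr0.
  apply/eqP/negP => /negP ya; have yr4 := Kr y yL.
  have yr' : `|y - a| < r by clear -yr r0; lra.
  have dfy := df y yr' ya.
  have d2 := differentiableZ e (dL y).1.
  have dF : differentiable F y by exact: differentiableD.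
  have pos : 0 < bil S (y - a) (X y).
    apply: lt_le_trans (mono y yr').
    by rewrite mulr_gt0 // sqn_gt0 // subr_eq0.
  have dLpos : 0 < 'd L y (X y).
    by apply: (eq_ind_r (fun s => 0 < s) _ ((dL y).2 (X y))); rewrite mulr_gt0.
  have dFpos : 0 < 'd F y (X y).
    have E1 := congr1 (fun G : V -> R => G (X y)) (diffD dfy d2).
    have E2 := congr1 (fun G : V -> R => G (X y)) (diffZ e (dL y).1).
    have E := etrans E1 (congr2 (fun s t => s + t) (inv y yr' ya) E2).
    apply: (eq_ind_r (fun s => 0 < s) _ E).
    by rewrite /= add0r mulr_gt0.
  have n1 := near_increase dF dFpos.
  have n2 := near_increase (dL y).1 dLpos.
  have n3 : \forall s \near (0 : R)^'+, `|y + s *: X y - a| < r / 2.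
    have rX : 0 < r / 4 / (`|X y| + 1) by rewrite !divr_gt0 // ltr_wpDl.
    near=> s; have s0 : 0 < s by near: s; exact: nbhs_right_gt.
    have sr : s < r / 4 / (`|X y| + 1) by near: s; exact: nbhs_right_lt.
    rewrite addrAC; apply: le_lt_trans (ler_normD _ _) _.
    rewrite normrZ gtr0_norm //.
    have : s * `|X y| < r / 4.
      apply: le_lt_trans (_ : s * (`|X y| + 1) < _); last by rewrite -ltr_pdivlMr // ltr_wpDl.
      by rewrite ler_wpM2l ?(ltW s0) // lerDl.
    by move: yr4; clear; move: `|X y| `|y - a| => n1 n2; lra.
  have [s [F1 [L1 n4]]] := filter_ex (filterI n1 (filterI n2 n3)).
  have := maxy (y + s *: X y); rewrite inE.
  have Ks : K (y + s *: X y).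
    split=> /=; first exact: ltW.
    by apply: le_trans yL; rewrite lerN2 ltW.
  by move=> /(_ Ks); rewrite leNgt F1.
pose rho := Num.min (r / 2) (Num.min 1 (r1 / (mxbound S + 1))).
have M0 : 0 < mxbound S + 1 by rewrite ltr_wpDl ?mxbound_ge0.
exists rho; first by rewrite !lt_min ltr01 !divr_gt0.
move=> x; rewrite !lt_min => /and3P[xr2 x1 xr1].
have Kx : K x.
  split=> /=; first exact: ltW.
  apply: (@le_trans _ _ `|L x|); first by rewrite -normrN ler_norm.
  apply: le_trans (bil_le _ _ _) _.
  apply: (@le_trans _ _ ((mxbound S + 1) * (r1 / (mxbound S + 1)) * 1)).
    apply: ler_pM; rewrite ?mulr_ge0 ?mxbound_ge0 ?(ltW x1) //.
    by apply: ler_pM; rewrite ?mxbound_ge0 ?lerDl // ltW.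
  by rewrite mulr1 mulrC mulfVK // gt_eqF.
apply/ler_addgt0Pr => e e0.
have e1 : 0 < e / (r1 + 1) by rewrite divr_gt0 // addr_gt0.
have := maxa _ e1 x Kx; have [_ /= Lx] := Kx.
have : e / (r1 + 1) * - L x <= e.
  apply: le_trans (ler_wpM2l (ltW e1) Lx) _.
  rewrite mulrAC ler_pdivrMr ?addr_gt0 // ler_wpM2l ?(ltW e0) //.
  by rewrite lerDl.
rewrite mulrN; clear; move: (e / _ * _) => z; lra.
Unshelve. all: by end_near. Qed.

Lemma grad_locally_constant f a x (r : R) : (forall y, `|y - a| < r -> f y = f a) ->
  `|x - a| < r -> grad f x = 0.
Proof.
move=> fa xr; apply/rowP => i; rewrite !mxE.
have nf : \forall y \near x, cst (f a) y = f y.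
  have h : \forall y \near x, `|y - a| < r by exact: near_norm_ball.
  by near=> y; rewrite fa //; near: y.
have dc : differentiable (cst (f a) : V -> R) x by [].
have [_ ->] := near_eq_diff nf dc.
by rewrite diff_cst.
Unshelve. all: by end_near. Qed.

(** [definite_upper_bound] applies to [f] and to [- f], so [f] is constant near a
    sink. *)
Lemma definite_grad0 X f a S (c r : R) : S^T = S -> 0 < c -> 0 < r -> X a = 0 ->
  C1_at X a -> (forall w, c * sqn w <= bil S w (w *m 'J X a)) ->
  (forall w, bil S w w <= 0) -> {for a, continuous f} ->
  (forall x, `|x - a| < r -> x != a -> differentiable f x) ->
  (forall x, `|x - a| < r -> x != a -> 'd f x (X x) = 0) ->
  exists2 rho : R, 0 < rho & forall x, `|x - a| < rho -> grad f x = 0.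
Proof.
move=> hS c0 r0 Xa X1 hyp neg fa df inv.
have [k k0 negS] := semidefinite_definite hS c0 hyp neg.
have [r1 r10 h1] := hyperbolic_monotone X1 c0 hyp.
pose s := Num.min r r1; have s0 : 0 < s by rewrite lt_min r0.
have c20 : 0 < c / 2 by rewrite divr_gt0.
have mono x : `|x - a| < s -> c / 2 * sqn (x - a) <= bil S (x - a) (X x).
  rewrite lt_min => /andP[_ xr1]; have := h1 x a xr1.
  by rewrite subrr normr0 Xa subr0; apply.
have sr x : `|x - a| < s -> `|x - a| < r by rewrite lt_min => /andP[].
have df' x : `|x - a| < s -> x != a -> differentiable f x by move=> /sr; exact: df.
have inv' x : `|x - a| < s -> x != a -> 'd f x (X x) = 0 by move=> /sr; exact: inv.
have [u u0 hu] := definite_upper_bound hS c20 k0 s0 mono negS fa df' inv'.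
have fa2 : {for a, continuous (- f)} by exact: (cvgN fa).
have df2 x : `|x - a| < s -> x != a -> differentiable (- f) x.
  by move=> xs xa; exact: (differentiableN (df' x xs xa)).
have inv2 x : `|x - a| < s -> x != a -> 'd (- f) x (X x) = 0.
  move=> xs xa; have E1 := congr1 (fun G : V -> R => G (X x)) (diffN (df' x xs xa)).
  by apply: (etrans E1); apply: (etrans (congr1 -%R (inv' x xs xa))); rewrite oppr0.
have [v v0 hv] := definite_upper_bound hS c20 k0 s0 mono negS fa2 df2 inv2.
exists (Num.min u v); first by rewrite lt_min u0.
move=> x xr; apply: (@grad_locally_constant f a x (Num.min u v)) => // y.
rewrite lt_min => /andP[/hu fy /hv]; rewrite /= !fctE lerN2 => fy'.
by apply/eqP; rewrite eq_le fy.
Qed.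

(** If the Lyapunov form of [X] has no positive direction the point is a sink, if it
    has no negative direction it is a sink of [- X], and otherwise it is a
    saddle. *)
Theorem hyperbolic_grad_cvg0 X f a (r : R) : 0 < r -> X a = 0 ->
  hyperbolic_mx ('J X a) ->
  (forall x, `|x - a| < r -> C1_at X x) ->
  {for a, continuous f} ->
  (forall x, `|x - a| < r -> x != a -> C1_at f x) ->
  (forall x, `|x - a| < r -> x != a -> 'd f x (X x) = 0) ->
  forall e : R, 0 < e -> exists2 rho : R, 0 < rho &
    forall x, `|x - a| < rho -> x != a -> `|grad f x| <= e.
Proof.
move=> r0 Xa hyp X1 fa f1 inv e e0.
have X1a : C1_at X a by apply: X1; rewrite subrr normr0.
have dXa := nbhs_singleton X1a.1.
have [S [c [hS c0] hypS]] := hyperbolic_lyapunov hyp.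
have [K [c' [hK c0'] hypK]] := hyperbolic_lyapunov (hyperbolic_mxT hyp).
have df x : `|x - a| < r -> x != a -> differentiable f x.
  by move=> xr xa; exact: (nbhs_singleton (f1 x xr xa).1).
have zero (rho : R) : 0 < rho -> (forall x, `|x - a| < rho -> grad f x = 0) ->
    exists2 rho : R, 0 < rho & forall x, `|x - a| < rho -> x != a -> `|grad f x| <= e.
  by move=> rho0 h; exists rho => // x /h -> _; rewrite normr0 ltW.
have [wpos|wpos] := pselect (exists w, 0 < bil S w w); last first.
  have neg w : bil S w w <= 0 by rewrite leNgt; apply/negP => h; apply: wpos; exists w.
  by have [rho rho0 h] := definite_grad0 hS c0 r0 Xa X1a hypS neg fa df inv; exact: zero h.
have [wneg|wneg] := pselect (exists w, bil S w w < 0); last first.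
  have S2 : (- S)^T = - S by rewrite linearN /= hS.
  have Xa2 : - X a = 0 by rewrite Xa oppr0.
  have hypS2 w : c * sqn w <= bil (- S) w (w *m 'J (fun u => - X u) a).
    by rewrite (jacobian_opp dXa) mulmxN bilNm bilNr opprK.
  have neg w : bil (- S) w w <= 0.
    rewrite bilNm oppr_le0 leNgt; apply/negP => h; apply: wneg; by exists w.
  have inv2 x : `|x - a| < r -> x != a -> 'd f x (- X x) = 0.
    by move=> xr xa; rewrite linearN /= (inv x xr xa) oppr0.
  have [rho rho0 h] := @definite_grad0 (fun u => - X u) f a (- S) c r S2 c0 r0 Xa2
                         (C1_opp X1a) hypS2 neg fa df inv2.
  exact: zero h.
exact: (saddle_grad_cvg0 hS hK c0 c0' r0 Xa X1 f1 inv hypS hypK wpos wneg).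
Qed.

(** By the mean value theorem on segments from [a], [f] is differentiable at [a] with
    differential [0], which is also the limit of the differentials nearby. *)
Theorem hyperbolic_C1_extension X f a (r : R) : 0 < r -> X a = 0 ->
  hyperbolic_mx ('J X a) ->
  (forall x, `|x - a| < r -> C1_at X x) ->
  {for a, continuous f} ->
  (forall x, `|x - a| < r -> x != a -> C1_at f x) ->
  (forall x, `|x - a| < r -> x != a -> 'd f x (X x) = 0) ->
  C1_at f a.
Proof.
move=> r0 Xa hyp X1 fa f1 inv.
have small := hyperbolic_grad_cvg0 r0 Xa hyp X1 fa f1 inv.
have B0 := mxbound_ge0 (1%:M : 'M[R]_d).
have df x : `|x - a| < r -> x != a -> differentiable f x.
  by move=> xr xa; exact: (nbhs_singleton (f1 x xr xa).1).
pose M : R := mxbound (1%:M : 'M[R]_d) + 1.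
have M0 : 0 < M by rewrite ltr_wpDl.
have smalld e : 0 < e -> exists2 rho : R, 0 < rho &
    forall x v, `|x - a| < rho -> x != a -> `|'d f x v| <= e * `|v|.
  move=> e0; have [rho rho0 h] := small (e / M) (divr_gt0 e0 M0).
  exists rho => // x v xr xa; have h' := h x xr xa.
  apply: (eq_ind_r (fun s : R => `|s| <= e * `|v|) _ (diff_grad f x v)).
  apply: le_trans (bil_le _ _ _) _; rewrite mulrAC ler_wpM2r //.
  apply: le_trans (ler_wpM2l B0 h') _; rewrite mulrCA ler_piMr ?(ltW e0) //.
  by rewrite ler_pdivrMr // mul1r lerDl.
have [dfa dfa0] : differentiable f a /\ forall v, 'd f a v = (fun=> 0 : R) v.
  apply: (@diff_normP _ V _ f (fun=> 0 : R) 0).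
  - by move=> b u v; rewrite scaler0 addr0.
  - by move=> v; rewrite normr0 mul0r.
  move=> e e0; have [rho rho0 h] := smalld e e0.
  apply/near_normP; exists (Num.min r rho); first by rewrite lt_min r0.
  move=> x; rewrite lt_min subr0 => /andP[xr xrho].
  have [->|xa] := eqVneq x a; first by rewrite !subrr !normr0 mulr0.
  have off (t : R) : 0 < t < 1 -> a + t *: (x - a) != a.
    move=> /andP[t0 _]; rewrite -subr_eq0 addrAC subrr add0r scaler_eq0.
    by rewrite gt_eqF //= subr_eq0.
  have a0 (s : R) : 0 < s -> `|a - a| < s by rewrite subrr normr0.
  have [||t t01 ->] := @segment_MVT _ _ f a x _ fa.
  - by move=> t t01; apply: df; [exact: segment_ball (a0 _ r0) xr|exact: off].
  - exact/differentiable_continuous/df.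
  by apply: h; [exact: segment_ball (a0 _ rho0) xrho|exact: off].
split.
  apply/near_normP; exists r => // x xr; have [->//|xa] := eqVneq x a.
  exact: df.
move=> v; apply/continuous_normP => e e0.
have ev : 0 < e / (`|v| + 1) by rewrite divr_gt0 // ltr_wpDl.
have [rho rho0 h] := smalld _ ev; apply/near_normP; exists rho => // x xrho.
apply: (eq_ind_r (fun s : R => `|'d f x v - s| < e) _ (dfa0 v)); rewrite subr0.
have [->|xa] := eqVneq x a.
  by apply: (eq_ind_r (fun s : R => `|s| < e) _ (dfa0 v)); rewrite normr0.
apply: le_lt_trans (h x v xrho xa) _.
by rewrite mulrAC ltr_pdivrMr ?ltr_wpDl // ltr_pM2l // ltrDl.
Qed.

End DefiniteCase.
(** * Collinear C1 fields on an open set of R^d *)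

Section C1Calculus.
Context {R : realType} {d : nat}.
Local Notation V := 'rV[R]_d.
Implicit Types (X Y : V -> V) (f g : V -> R) (x y a v w p : V) (A B : 'M[R]_d).

Lemma C1_at_near_eq (W : normedModType (R : numFieldType)) (F G : V -> W) x :
  (\forall u \near x, F u = G u) -> C1_at F x -> C1_at G x.
Proof.
move=> FG [dF cF]; have FG2 : \forall u \near x, \forall t \near u, F t = G t.
  have /near_normP[r r0 h] := FG; apply/near_normP; exists r => // u ur.
  have n : \forall t \near u, `|t - x| < r by exact: near_norm_ball.
  by near=> t; apply: h; near: t.
have key : \forall u \near x, differentiable G u /\ forall v, 'd G u v = 'd F u v.
  by near=> u; apply: near_eq_diff; near: u.
split; first by apply: filterS key => u [].
move=> v; apply/continuous_normP => e e0.
have /continuous_normP/(_ e e0) h := cF v; have [_ kx] := nbhs_singleton key.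
apply: filterS2 key h => u [_ ku].
have E := congr2 (fun s t : W => s - t) (ku v) (kx v).
by move=> h; apply: (eq_ind_r (fun s : W => `|s| < e) _ E).
Unshelve. all: by end_near. Qed.

Lemma C1_at_continuous (W : normedModType (R : numFieldType)) (F : V -> W) x :
  C1_at F x -> {for x, continuous F}.
Proof. by move=> [dF _]; exact: (differentiable_continuous (nbhs_singleton dF)). Qed.

Lemma C1_at_mul f g x : C1_at f x -> C1_at g x -> C1_at (f * g) x.
Proof.
move=> f1 g1; have [df cf] := f1; have [dg cg] := g1.
have D : \forall u \near x, differentiable (f * g) u /\
    forall v, 'd (f * g) u v = f u * 'd g u v + g u * 'd f u v.
  near=> u; have du : differentiable f u by near: u.
  have dv : differentiable g u by near: u.
  split; first exact: differentiableM.
  move=> v; have E := congr1 (fun F : V -> R => F v) (diffM du dv); exact: E.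
split; first by apply: filterS D => u [].
move=> v; have c : {for x, continuous (fun u => f u * 'd g u v + g u * 'd f u v)}.
  exact: (cvgD (cvgM (C1_at_continuous f1) (cg v)) (cvgM (C1_at_continuous g1) (cf v))).
have [_ Dx] := nbhs_singleton D.
apply/continuous_normP => e e0; move/continuous_normP : c => /(_ e e0).
apply: filterS2 D => u [_ Du].
have E := congr2 (fun s t : R => s - t) (Du v) (Dx v).
by move=> h; apply: (eq_ind_r (fun s : R => `|s| < e) _ E).
Unshelve. all: by end_near. Qed.

Lemma C1_at_inv g x : C1_at g x -> g x != 0 -> C1_at (fun u => (g u)^-1) x.
Proof.
move=> g1 gx0; have [dg cg] := g1; have gc := C1_at_continuous g1.
have ng : \forall u \near x, g u != 0.
  have e0 : 0 < `|g x| by rewrite normr_gt0.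
  have /continuous_normP/(_ _ e0) h := gc; apply: filterS h => u.
  by apply: contraTneq => ->; rewrite sub0r normrN ltxx.
have D : \forall u \near x, differentiable (fun u => (g u)^-1) u /\
    forall v, 'd (fun u => (g u)^-1) u v = - ((g u)^-1 * (g u)^-1 * 'd g u v).
  near=> u; have du : differentiable g u by near: u.
  have gu : g u != 0 by near: u.
  split; first exact: differentiableV.
  move=> v; have E := congr1 (fun F : V -> R => F v) (diffV du gu).
  by apply: (etrans E); rewrite /= /GRing.scale /= expr2 invfM mulNr.
split; first by apply: filterS D => u [].
move=> v; have ci : {for x, continuous (fun u => (g u)^-1)} by exact: (cvgV gx0 gc).
have c : {for x, continuous (fun u => - ((g u)^-1 * (g u)^-1 * 'd g u v))}.
  exact: (cvgN (cvgM (cvgM ci ci) (cg v))).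
have [_ Dx] := nbhs_singleton D.
apply/continuous_normP => e e0; move/continuous_normP : c => /(_ e e0).
apply: filterS2 D => u [_ Du].
have E := congr2 (fun s t : R => s - t) (Du v) (Dx v).
by move=> h; apply: (eq_ind_r (fun s : R => `|s| < e) _ E).
Unshelve. all: by end_near. Qed.

Lemma C1_at_comp g (F : V -> V) x : C1_at F x -> C1_at g (F x) -> C1_at (g \o F) x.
Proof.
move=> F1 g1; have [dF cF] := F1; have [dg _] := g1.
have Fc := C1_at_continuous F1.
have ndg : \forall u \near x, differentiable g (F u) by exact: (Fc _ dg).
have D : \forall u \near x, differentiable (g \o F) u /\
    forall v, 'd (g \o F) u v = bil 1%:M ('d F u v) (grad g (F u)).
  near=> u; have du : differentiable F u by near: u.
  have dv : differentiable g (F u) by near: u.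
  split; first exact: differentiable_comp.
  move=> v; have E := congr1 (fun G : V -> R => G v) (diff_comp du dv).
  by apply: (etrans E) => /=; exact: diff_grad.
split; first by apply: filterS D => u [].
move=> v; have c : {for x, continuous (fun u => bil 1%:M ('d F u v) (grad g (F u)))}.
  have c1 := cF v.
  have c2 : {for x, continuous (grad g \o F)} by exact: (continuous_comp Fc (continuous_grad g1)).
  exact: (cvg_bil _ c1 c2).
have [_ Dx] := nbhs_singleton D.
apply/continuous_normP => e e0; move/continuous_normP : c => /(_ e e0).
apply: filterS2 D => u [_ Du].
have E := congr2 (fun s t : R => s - t) (Du v) (Dx v).
by move=> h; apply: (eq_ind_r (fun s : R => `|s| < e) _ E).
Unshelve. all: by end_near. Qed.

Lemma row_neq0_coord v : v != 0 -> exists k, v 0 k != 0.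
Proof.
move=> v0; apply/existsP; apply: contraT; rewrite negb_exists => /forallP h.
case/eqP: v0; apply/rowP => k; rewrite mxE.
by have := h k; rewrite negbK => /eqP.
Qed.

(** Divide one coordinate of the relation by a coordinate of [X] that does not
    vanish at [x]. *)
Lemma C1_at_factor X Y f x : C1_at X x -> C1_at Y x -> X x != 0 ->
  (\forall u \near x, Y u = f u *: X u) -> C1_at f x.
Proof.
move=> X1 Y1 /row_neq0_coord[k Xk] YfX.
have Xk1 := C1_coord k X1; have Yk1 := C1_coord k Y1.
apply: C1_at_near_eq (C1_at_mul Yk1 (C1_at_inv Xk1 Xk)).
have e0 : 0 < `|X x 0 k| by rewrite normr_gt0.
have /continuous_normP/(_ _ e0) h := C1_at_continuous Xk1.
apply: filterS2 h YfX => u hu Yu; rewrite /= !fctE Yu mxE mulfK //.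
by apply: contraTneq hu => ->; rewrite sub0r normrN ltxx.
Qed.

(** By the Leibniz rule the bracket is the derivative of [f] along [X], times [X]. *)
Lemma bracket_factor X Y f x : C1_at X x -> C1_at Y x -> C1_at f x -> X x != 0 ->
  (\forall u \near x, Y u = f u *: X u) ->
  'd Y x (X x) - 'd X x (Y x) = 0 -> 'd f x (X x) = 0.
Proof.
move=> X1 Y1 f1 Xx0 YfX br; have [k Xk] := row_neq0_coord Xx0.
have dX := nbhs_singleton X1.1; have dY := nbhs_singleton Y1.1.
have df := nbhs_singleton f1.1.
have [dXk eXk] := diff_coord (X x) k dX.
have [_ eYk] := diff_coord (X x) k dY.
have nk : \forall u \near x, (f * (fun u => X u 0 k)) u = Y u 0 k.
  by apply: filterS YfX => u ->; rewrite mxE.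
have [_ ek] := near_eq_diff nk (differentiableM df dXk).
have E1 := congr1 (fun F : V -> R => F (X x)) (diffM df dXk).
have E2 := etrans (esym eYk) (etrans (ek (X x)) E1).
have eXY : 'd X x (Y x) = f x *: 'd X x (X x).
  by rewrite (nbhs_singleton YfX) linearZ.
have brk := congr1 (fun w : V => w 0 k) (etrans (subr0_eq br) eXY).
have scaleE (b : R) w : (b *: w) 0 k = b * w 0 k by rewrite mxE.
have cancel (b q s t w : R) : b * t + q * s = b * w -> t = w -> q * s = 0.
  by move=> + tw; rewrite tw => h; apply: (addrI (b * w)); rewrite h addr0.
have E3 : X x 0 k * 'd f x (X x) = 0.
  exact: (cancel _ _ _ _ _ (etrans (esym E2) (etrans brk (scaleE _ _))) eXk).
by move/eqP: E3; rewrite mulf_eq0 (negPf Xk) => /eqP.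
Qed.

Lemma directional_cvg X a v : differentiable X a -> X a = 0 ->
  t^-1 *: X (a + t *: v) @[t --> (0 : R)^'+] --> 'd X a v.
Proof.
move=> dX Xa; apply/cvgrPdist_le => e e0.
have ev : 0 < e / (`|v| + 1) by rewrite divr_gt0 // ltr_wpDl.
have /near_normP[r r0 hr] := diff_norm dX ev.
have n1 : 0 < r / (`|v| + 1) by rewrite divr_gt0 // ltr_wpDl.
near=> t; have t0 : 0 < t by near: t; exact: nbhs_right_gt.
have tr : t < r / (`|v| + 1) by near: t; exact: nbhs_right_lt.
have := hr (a + t *: v).
have -> : a + t *: v - a = t *: v by rewrite addrAC subrr add0r.
rewrite linearZ /= normrZ gtr0_norm // Xa subr0 => /(_ _)/wrap[].
  apply: le_lt_trans (_ : t * (`|v| + 1) < r); last by rewrite -ltr_pdivlMr // ltr_wpDl.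
  by rewrite ler_wpM2l ?(ltW t0) // lerDl.
move=> h; rewrite distrC -(ler_pM2l t0) -{1}(gtr0_norm t0) -normrZ.
rewrite scalerBr scalerA mulfV ?gt_eqF // scale1r; apply: le_trans h _.
rewrite mulrCA ler_wpM2l ?(ltW t0) // mulrAC ler_pdivrMr ?ltr_wpDl //.
by rewrite ler_wpM2l ?(ltW e0) // lerDl.
Unshelve. all: by end_near. Qed.

(** Divide the collinearity relation at [a + t v] by [t^2] and let [t] tend to [0]. *)
Lemma collinear_jacobian X Y a v k l : differentiable X a -> differentiable Y a ->
  X a = 0 -> Y a = 0 ->
  (\forall u \near a, X u 0 k * Y u 0 l = X u 0 l * Y u 0 k) ->
  (v *m 'J X a) 0 k * (v *m 'J Y a) 0 l = (v *m 'J X a) 0 l * (v *m 'J Y a) 0 k.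
Proof.
move=> dX dY Xa Ya col.
have cX := directional_cvg (v := v) dX Xa; have cY := directional_cvg (v := v) dY Ya.
have c (F : V -> V) (l0 : V) j : t^-1 *: F (a + t *: v) @[t --> (0 : R)^'+] --> l0 ->
    (t^-1 *: F (a + t *: v)) 0 j @[t --> (0 : R)^'+] --> l0 0 j.
  move=> /cvgrPdist_le h; apply/cvgrPdist_le => e e0; apply: filterS (h e e0) => t.
  by apply: le_trans; have := coord_norm_le (l0 - t^-1 *: F (a + t *: v)) j; rewrite !mxE.
pose G (t : R) := (t^-1 *: X (a + t *: v)) 0 k * (t^-1 *: Y (a + t *: v)) 0 l.
pose H (t : R) := (t^-1 *: X (a + t *: v)) 0 l * (t^-1 *: Y (a + t *: v)) 0 k.
have P1 : G t @[t --> (0 : R)^'+] --> 'd X a v 0 k * 'd Y a v 0 l.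
  exact: (cvgM (c X _ k cX) (c Y _ l cY)).
have P2 : H t @[t --> (0 : R)^'+] --> 'd X a v 0 l * 'd Y a v 0 k.
  exact: (cvgM (c X _ l cX) (c Y _ k cY)).
suff GH : \forall t \near (0 : R)^'+, H t = G t.
  have P3 : G t @[t --> (0 : R)^'+] --> 'd X a v 0 l * 'd Y a v 0 k.
    by apply: cvg_trans P2; exact: near_eq_cvg.
  have transfer (s1 t1 s2 t2 : V) : s1 = s2 -> t1 = t2 ->
    s1 0 k * t1 0 l = s1 0 l * t1 0 k -> s2 0 k * t2 0 l = s2 0 l * t2 0 k by move=> -> ->.
  apply: transfer (diff_jacobian X a v) (diff_jacobian Y a v) _.
  exact: (cvg_unique (@Rhausdorff R) P1 P3).
have /near_normP[r r0 hr] := col.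
have n1 : 0 < r / (`|v| + 1) by rewrite divr_gt0 // ltr_wpDl.
near=> t; have t0 : 0 < t by near: t; exact: nbhs_right_gt.
have tr : t < r / (`|v| + 1) by near: t; exact: nbhs_right_lt.
rewrite /G /H !mxE mulrACA [RHS]mulrACA; congr (_ * _); apply/esym/hr.
rewrite addrAC subrr add0r normrZ gtr0_norm //.
apply: le_lt_trans (_ : t * (`|v| + 1) < r); last by rewrite -ltr_pdivlMr // ltr_wpDl.
by rewrite ler_wpM2l ?(ltW t0) // lerDl.
Unshelve. all: by end_near. Qed.

(** Every row vector is an eigenvector of [A^-1 B]; testing on the basis vectors and
    on their pairwise sums shows that this matrix is scalar. *)
Lemma collinear_scalar (i0 : 'I_d) A B : A \in unitmx ->
  (forall v k l, (v *m A) 0 k * (v *m B) 0 l = (v *m A) 0 l * (v *m B) 0 k) ->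
  exists c : R, B = c *: A.
Proof.
move=> Au h.
have [N BE hN] : exists2 N : 'M[R]_d, B = A *m N &
    forall w k l, w 0 k * (w *m N) 0 l = w 0 l * (w *m N) 0 k.
  exists (invmx A *m B) => [|w k l]; first by rewrite mulKVmx.
  by have := h (w *m invmx A) k l; rewrite mulmxKV // mulmxA.
have off i l : l != i -> N i l = 0.
  move=> li; have := hN 'e_i i l; rewrite -!rowE !mxE !eqxx /= (negPf li) mul0r mul1r.
  by [].
have diag i j : N i i = N j j.
  have [->//|ij] := eqVneq i j.
  have := hN ('e_i + 'e_j) i j.
  rewrite !mulmxDl -!rowE !mxE !eqxx /= (negPf ij) eq_sym (negPf ij) /=.
  rewrite (off i j) ?(off j i) // 1?eq_sym // !addr0 !add0r !mul1r.
  by move=> ->.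
exists (N i0 i0); rewrite BE.
have -> : N = (N i0 i0)%:M.
  apply/matrixP => i l; rewrite [RHS]mxE; have [<-|il] := eqVneq i l.
    by rewrite mulr1n; exact: diag.
  by rewrite mulr0n off // eq_sym.
by rewrite mul_mx_scalar mxE eqxx mulr1n.
Qed.

Lemma C1_taylor X a (e : R) : C1_at X a -> X a = 0 -> 0 < e ->
  \forall u \near a, `|X u - (u - a) *m 'J X a| <= e * `|u - a|.
Proof.
move=> X1 Xa e0; have [r r0 h] := C1_strict X1 e0.
apply/near_normP; exists r => // u ur.
by have := h a u; rewrite subrr normr0 Xa subr0; apply.
Qed.

(** Since [A = 'J X a] is invertible, [|X u|] is at least a multiple of [|u - a|],
    whereas [(f u - c) X u = Y u - c X u = o(u - a)]. *)
Lemma factor_limit X Y f a (c : R) : C1_at X a -> C1_at Y a -> X a = 0 -> Y a = 0 ->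
  'J X a \in unitmx -> 'J Y a = c *: 'J X a ->
  (\forall u \near a, Y u = f u *: X u) -> f a = c ->
  {for a, continuous f} /\ exists2 r : R, 0 < r &
    forall u, `|u - a| < r -> u != a -> X u != 0.
Proof.
move=> X1 Y1 Xa Ya Au JYX YfX fa.
pose m := mxbound (invmx ('J X a)) + 1.
have m0 : 0 < m by rewrite ltr_wpDl ?mxbound_ge0.
have m20 : 0 < (2 * m)^-1 by rewrite invr_gt0 mulr_gt0.
have low w : m^-1 * `|w| <= `|w *m 'J X a|.
  rewrite ler_pdivrMl // -{1}(mulmxK Au w); apply: le_trans (normM_le _ _) _.
  by rewrite ler_wpM2r // lerDl.
have lowX : \forall u \near a, (2 * m)^-1 * `|u - a| <= `|X u|.
  apply: filterS (C1_taylor X1 Xa m20) => u h.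
  have := low (u - a).
  have := ler_normB (X u) (X u - (u - a) *m 'J X a).
  rewrite opprB addrCA subrr addr0.
  have -> : (2 * m)^-1 = m^-1 / 2 by rewrite invfM mulrC.
  move: h; rewrite invfM; clear.
  move: (`|X u - _|) (`|X u|) (`|_ *m _|) => n1 n2 n3.
  have -> : 2^-1 * m^-1 * `|u - a| = (m^-1 * `|u - a|) / 2 by ring.
  have -> : m^-1 / 2 * `|u - a| = (m^-1 * `|u - a|) / 2 by ring.
  by move: (m^-1 * _) => s; lra.
split; last first.
  have /near_normP[r r0 h] := lowX; exists r => // u ur ua.
  rewrite -normr_gt0; apply: lt_le_trans (h u ur).
  by rewrite mulr_gt0 // normr_gt0 subr_eq0.
apply/continuous_normP => e e0; rewrite fa.
have e10 : 0 < e / 4 * (2 * m)^-1 by rewrite mulr_gt0 // divr_gt0.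
have e20 : 0 < e / 4 * (2 * m)^-1 / (`|c| + 1) by rewrite divr_gt0 // ltr_wpDl.
have hY := C1_taylor Y1 Ya e10.
have hX := C1_taylor X1 Xa e20.
near=> u; have [->|ua] := eqVneq u a; first by rewrite fa subrr normr0.
have n0 : 0 < `|u - a| by rewrite normr_gt0 subr_eq0.
have YfXu : Y u = f u *: X u by near: u.
have lu : (2 * m)^-1 * `|u - a| <= `|X u| by near: u.
have : `|Y u - (u - a) *m 'J Y a| <= e / 4 * (2 * m)^-1 * `|u - a| by near: u.
have : `|X u - (u - a) *m 'J X a| <= e / 4 * (2 * m)^-1 / (`|c| + 1) * `|u - a| by near: u.
rewrite JYX -scalemxAr => h1 h2.
have X0 : 0 < `|X u| by apply: lt_le_trans lu; rewrite mulr_gt0.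
rewrite -(ltr_pM2r X0) -normrZ.
have -> : (f u - c) *: X u = (Y u - c *: ((u - a) *m 'J X a)) - c *: (X u - (u - a) *m 'J X a).
  by rewrite YfXu scalerBl scalerBr opprB addrA subrK.
apply: le_lt_trans (ler_normB _ _) _; rewrite normrZ.
have h3 : `|c| * `|X u - (u - a) *m 'J X a| <= e / 4 * (2 * m)^-1 * `|u - a|.
  apply: le_trans (ler_wpM2l (normr_ge0 c) h1) _.
  have -> : `|c| * (e / 4 * (2 * m)^-1 / (`|c| + 1) * `|u - a|) =
     (e / 4 * (2 * m)^-1 * `|u - a|) * (`|c| / (`|c| + 1)).
    by field; rewrite !gt_eqF // ltr_wpDl.
  apply: ler_piMr; first exact: mulr_ge0 (ltW e10) (normr_ge0 _).
  by rewrite ler_pdivrMr ?ltr_wpDl // mul1r lerDl.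
apply: le_lt_trans (lerD h2 h3) _.
apply: (@le_lt_trans _ _ (e / 2 * `|X u|)).
  have -> : e / 4 * (2 * m)^-1 * `|u - a| + e / 4 * (2 * m)^-1 * `|u - a| =
    e / 2 * ((2 * m)^-1 * `|u - a|) by field; rewrite gt_eqF.
  by rewrite ler_wpM2l // divr_ge0 // ltW.
by rewrite ltr_pM2r //; clear -e0; lra.
Unshelve. all: by end_near. Qed.

End C1Calculus.
(** * Vector fields and functions in charts *)

Section Charts.
Context {R : realType} {d : nat} {M : smooth_manifold R d}.
Implicit Types (X Y : vector_field M) (f : M -> R) (i j : chart_index M) (u v w : 'rV[R]_d).

Lemma Ck1_C1_at (U : set 'rV[R]_d) (W : normedModType (R : numFieldType))
    (F : 'rV[R]_d -> W) u : open U -> Ck_on 1 U F -> U u -> C1_at F u.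
Proof.
move=> oU [dF cF] Uu; have nU : \forall t \near u, U t by exact: open_nbhs_nbhs.
by split=> [|v]; [apply: filterS nU => t; exact: dF|exact: cF].
Qed.

Lemma C1_at_Ck1 (U : set 'rV[R]_d) (W : normedModType (R : numFieldType))
    (F : 'rV[R]_d -> W) : (forall u, U u -> C1_at F u) -> Ck_on 1 U F.
Proof.
by move=> F1; split=> [u /F1[dF _]|v u /F1[_ cF]]; [exact: (nbhs_singleton dF)|exact: cF].
Qed.

Lemma near_chart i j u : cod (atlas i) u -> dom (atlas j) (of_coord (atlas i) u) ->
  \forall t \near u, cod (atlas i) t /\ dom (atlas j) (of_coord (atlas i) t).
Proof.
move=> iu ju.
have n1 : \forall t \near u, cod (atlas i) t.
  by apply: open_nbhs_nbhs; split; [exact: open_cod|].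
have n2 : \forall y \near of_coord (atlas i) u, dom (atlas j) y.
  by apply: open_nbhs_nbhs; split; [exact: open_dom|].
have n3 := of_coord_continuous iu n2.
by near=> t; split; near: t.
Unshelve. all: by end_near. Qed.

Definition transition i j : 'rV[R]_d -> 'rV[R]_d :=
  to_coord (atlas j) \o of_coord (atlas i).

Lemma transition_C1 i j u : cod (atlas i) u -> dom (atlas j) (of_coord (atlas i) u) ->
  C1_at (transition i j) u.
Proof.
move=> iu ju; have [dT cT] := transition_smooth i j 1.
split; last by move=> v; apply: cT; split.
by apply: filterS (near_chart iu ju) => t [ti tj]; apply: dT; split.
Qed.

(** Reading [f] in chart [i] is reading it in chart [j] after the transition map,
    where both charts are defined. *)
Lemma near_transition f i j u : cod (atlas i) u -> dom (atlas j) (of_coord (atlas i) u) ->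
  \forall t \near u, ((f \o of_coord (atlas j)) \o transition i j) t
                      = (f \o of_coord (atlas i)) t.
Proof.
move=> iu ju; apply: filterS (near_chart iu ju) => t [ti tj].
by rewrite /transition /= to_coordK.
Qed.

Lemma coord_at_cod (x : M) : cod (chart_near x) (coord_at x).
Proof. by apply: to_coord_cod; exact: chart_at_dom. Qed.

Lemma of_coord_at (x : M) : of_coord (chart_near x) (coord_at x) = x.
Proof. by apply: to_coordK; exact: chart_at_dom. Qed.

Lemma field_inE i X u : field_in i X u =
  'd (transition (chart_at (of_coord (atlas i) u)) i)
     (coord_at (of_coord (atlas i) u)) (X (of_coord (atlas i) u)).
Proof. by []. Qed.

Lemma field_in_scale i X Y u (c : R) :
  Y (of_coord (atlas i) u) = c *: X (of_coord (atlas i) u) ->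
  field_in i Y u = c *: field_in i X u.
Proof. by move=> e; rewrite !field_inE e linearZ. Qed.

Lemma field_in0 i X u : X (of_coord (atlas i) u) = 0 -> field_in i X u = 0.
Proof. by move=> e; rewrite field_inE e linear0. Qed.

(** Transition maps are local diffeomorphisms, so a field vanishes at a point if and
    only if its representatives do. *)
Lemma diff_transitionK i (y : M) v : dom (atlas i) y ->
  'd (transition i (chart_at y)) (to_coord (atlas i) y)
     ('d (transition (chart_at y) i) (coord_at y) v) = v.
Proof.
move=> iy; set j := chart_at y.
have jy : cod (atlas j) (coord_at y) by exact: coord_at_cod.
have iy' : dom (atlas i) (of_coord (atlas j) (coord_at y)) by rewrite of_coord_at.
have d1 := nbhs_singleton (transition_C1 jy iy').1.
have e1 : transition j i (coord_at y) = to_coord (atlas i) y.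
  by rewrite /transition /= of_coord_at.
have iu : cod (atlas i) (to_coord (atlas i) y) by exact: to_coord_cod.
have ju : dom (atlas j) (of_coord (atlas i) (to_coord (atlas i) y)).
  by rewrite to_coordK //; exact: chart_at_dom.
have d2 := nbhs_singleton (transition_C1 iu ju).1.
rewrite -e1 in d2 *.
have n : \forall t \near coord_at y, (transition i j \o transition j i) t = id t.
  apply: filterS (near_chart jy iy') => t [tj ti].
  by rewrite /transition /= to_coordK // of_coordK.
have [_ E1] := near_eq_diff n (differentiable_comp d1 d2).
have E2 := congr1 (fun F : 'rV[R]_d -> 'rV[R]_d => F v) (diff_comp d1 d2).
apply: (etrans (esym E2)); apply: (etrans (esym (E1 v))).
have did : is_diff (coord_at y) (id : 'rV[R]_d -> 'rV[R]_d) id by exact: is_diff_id.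
by rewrite diff_val.
Qed.

Lemma field_in_chart_at X (x : M) : field_in (chart_at x) X (coord_at x) = X x.
Proof.
rewrite field_inE of_coord_at.
have jy := coord_at_cod x.
have n : \forall t \near coord_at x, id t = transition (chart_at x) (chart_at x) t.
  have jx : dom (atlas (chart_at x)) (of_coord (atlas (chart_at x)) (coord_at x)).
    by rewrite of_coord_at; exact: chart_at_dom.
  by apply: filterS (near_chart jy jx) => t [tj _]; rewrite /transition /= of_coordK.
have did : is_diff (coord_at x) (id : 'rV[R]_d -> 'rV[R]_d) id by exact: is_diff_id.
have [_ E1] := near_eq_diff n ex_diff.
by apply: (etrans (E1 _)); rewrite diff_val.
Qed.

Lemma field_in_neq0 i X u : cod (atlas i) u ->
  X (of_coord (atlas i) u) != 0 -> field_in i X u != 0.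
Proof.
move=> iu; apply: contraNneq => F0.
have h := diff_transitionK (X (of_coord (atlas i) u)) (of_coord_dom iu).
apply/eqP; apply: (etrans (esym h)).
apply: (etrans (congr1 (fun w => 'd (transition i _) _ w) F0)); exact: linear0.
Qed.

(** The derivative of [f] along [X] may be computed in any chart; the definition uses
    the chart chosen at the point. *)
Lemma diff_along_field f i X u : cod (atlas i) u ->
  differentiable (f \o of_coord (atlas i)) u ->
  'd (f \o of_coord (atlas i)) u (field_in i X u) =
  lie_derivative X f (of_coord (atlas i) u).
Proof.
move=> iu df; set y := of_coord (atlas i) u; set j := chart_at y.
have jy : cod (atlas j) (coord_at y) by exact: coord_at_cod.
have yE : of_coord (atlas j) (coord_at y) = y by exact: of_coord_at.
have iy : dom (atlas i) (of_coord (atlas j) (coord_at y)).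
  by rewrite yE; exact: of_coord_dom.
have d1 := nbhs_singleton (transition_C1 jy iy).1.
have e1 : transition j i (coord_at y) = u.
  by rewrite /transition /= yE /y of_coordK.
have d2 : differentiable (f \o of_coord (atlas i)) (transition j i (coord_at y)).
  by rewrite e1.
have [_ E1] := near_eq_diff (near_transition f jy iy) (differentiable_comp d1 d2).
have E2 := congr1 (fun F : 'rV[R]_d -> R => F (X y)) (diff_comp d1 d2).
apply/esym; apply: (etrans (E1 (X y))); apply: (etrans E2).
exact: (congr1 (fun t => 'd (f \o of_coord (atlas i)) t (field_in i X u)) e1).
Qed.

Lemma C1_at_transition f i j u : cod (atlas i) u ->
  dom (atlas j) (of_coord (atlas i) u) ->
  C1_at (f \o of_coord (atlas j)) (transition i j u) ->
  C1_at (f \o of_coord (atlas i)) u.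
Proof.
move=> iu ju f1; apply: C1_at_near_eq (near_transition f iu ju) _.
by apply: C1_at_comp => //; exact: transition_C1.
Qed.

End Charts.
(** * The proportionality factor *)

Section QuasiTrivial.
Context {R : realType} {d : nat} {M : smooth_manifold R d}.
Implicit Types (X Y : vector_field M) (f : M -> R) (i j : chart_index M) (u v w : 'rV[R]_d).

Lemma collinear_factor v w : v != 0 -> (\dim <<[:: v; w]>>%VS <= 1)%N ->
  exists c : R, w = c *: v.
Proof.
move=> v0 dim1.
have sub : (<[v]> <= <<[:: v; w]>>)%VS by rewrite -memvE memv_span // mem_head.
have : w \in <[v]>%VS.
  have -> : <[v]>%VS = <<[:: v; w]>>%VS.
    by apply/eqP; rewrite eqEdim sub dim_vline v0.
  by apply: memv_span; rewrite in_cons mem_head orbT.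
by move=> /vlineP[c ->]; exists c.
Qed.

Lemma C1_field_at i X u : C1_field X -> cod (atlas i) u -> C1_at (field_in i X) u.
Proof. by move=> X1; apply: Ck1_C1_at (X1 i); exact: open_cod. Qed.

Lemma centralizer_singularity X Y (s : M) : X s = 0 -> hyperbolic X s ->
  lie_bracket X Y s = 0 -> Y s = 0.
Proof.
move=> Xs hyp br.
have dY0 : 'd (field_in (chart_at s) Y) (coord_at s) (X s) = 0.
  by rewrite Xs linear0.
have YA : Y s *m linear_part X s = 0.
  apply: etrans (etrans (esym (subr0_eq br)) dY0); apply: esym; exact: diff_jacobian.
by rewrite -(mulmxK (hyperbolic_unitmx hyp) (Y s)) YA mul0mx.
Qed.

Lemma near_singular_collinear X Y (s : M) k l :
  (forall x, X x != 0 -> exists c : R, Y x = c *: X x) ->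
  (forall x, X x = 0 -> Y x = 0) ->
  \forall u \near coord_at s,
    field_in (chart_at s) X u 0 k * field_in (chart_at s) Y u 0 l =
    field_in (chart_at s) X u 0 l * field_in (chart_at s) Y u 0 k.
Proof.
move=> fac zer; near=> u.
have [X0|X0] := eqVneq (X (of_coord (atlas (chart_at s)) u)) 0.
  by rewrite (field_in0 (X := X)) // !mxE !mul0r.
have [c Yc] := fac _ X0; rewrite (field_in_scale Yc) !mxE; ring.
Unshelve. all: by end_near. Qed.

(** At a singular point the relation [Y = f X] says nothing about [f]; its value there
    is prescribed as the ratio of the linear parts. *)
Lemma centralizer_factor X Y (i0 : 'I_d) : C1_field X -> C1_field Y ->
  (forall s, X s = 0 -> hyperbolic X s) ->
  (forall x, X x != 0 -> exists c : R, Y x = c *: X x) ->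
  (forall x, X x = 0 -> Y x = 0) ->
  exists f, (forall x, Y x = f x *: X x) /\
    forall s, X s = 0 -> linear_part Y s = f s *: linear_part X s.
Proof.
move=> X1 Y1 hyp fac zer.
have /choice[f hf] : forall x, exists c : R,
    Y x = c *: X x /\ (X x = 0 -> linear_part Y x = c *: linear_part X x).
  move=> x; have [X0|X0] := eqVneq (X x) 0; last first.
    by have [c Yc] := fac x X0; exists c; split=> // /eqP; rewrite (negPf X0).
  have jx := coord_at_cod x.
  have X1x := C1_field_at X1 jx; have Y1x := C1_field_at Y1 jx.
  have [||c JYX] := @collinear_scalar _ _ i0 (linear_part X x) (linear_part Y x).
  - exact: hyperbolic_unitmx (hyp x X0).
  - move=> v k l; apply: collinear_jacobian.
    + exact: (nbhs_singleton X1x.1).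
    + exact: (nbhs_singleton Y1x.1).
    + by rewrite field_in_chart_at.
    + by rewrite field_in_chart_at zer.
    + exact: near_singular_collinear.
  by exists c; rewrite X0 zer // scaler0.
exists f; split=> [x|s s0]; first exact: (hf x).1.
exact: (hf s).2.
Qed.

Lemma factor_C1_regular X Y f i u : C1_field X -> C1_field Y ->
  (forall x, Y x = f x *: X x) -> cod (atlas i) u ->
  X (of_coord (atlas i) u) != 0 -> C1_at (f \o of_coord (atlas i)) u.
Proof.
move=> X1 Y1 YfX iu X0.
apply: (C1_at_factor (C1_field_at X1 iu) (C1_field_at Y1 iu)).
  exact: field_in_neq0.
by near=> t; exact: field_in_scale.
Unshelve. all: by end_near. Qed.

Lemma factor_invariant_regular X Y f x : C1_field X -> C1_field Y ->
  (forall x, Y x = f x *: X x) -> lie_bracket X Y x = 0 -> X x != 0 ->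
  lie_derivative X f x = 0.
Proof.
move=> X1 Y1 YfX br X0; have jx := coord_at_cod x.
have X0' : X (of_coord (atlas (chart_at x)) (coord_at x)) != 0 by rewrite of_coord_at.
have f1 := factor_C1_regular X1 Y1 YfX jx X0'.
have X0'' := field_in_neq0 jx X0'.
rewrite /lie_derivative -(field_in_chart_at X x).
apply: (bracket_factor (C1_field_at X1 jx) (C1_field_at Y1 jx) f1 X0'').
  by near=> t; exact: field_in_scale.
by rewrite !field_in_chart_at.
Unshelve. all: by end_near. Qed.

Lemma factor_C1_singular X Y f (s : M) : C1_field X -> C1_field Y ->
  (forall x, Y x = f x *: X x) -> (forall x, lie_bracket X Y x = 0) ->
  X s = 0 -> hyperbolic X s -> linear_part Y s = f s *: linear_part X s ->
  C1_at (f \o of_coord (chart_near s)) (coord_at s).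
Proof.
move=> X1 Y1 YfX br Xs hyp JYX; set j := chart_at s; set a := coord_at s.
have ja : cod (atlas j) a by exact: coord_at_cod.
have Xa : field_in j X a = 0 by rewrite field_in_chart_at.
have Ya : field_in j Y a = 0 by rewrite field_in_chart_at YfX Xs scaler0.
have fas : (f \o of_coord (atlas j)) a = f s by rewrite /= of_coord_at.
have [|fa [r r0 Xr]] := factor_limit (C1_field_at X1 ja) (C1_field_at Y1 ja) Xa Ya
   (hyperbolic_unitmx hyp) JYX _ fas.
  by near=> t; exact: field_in_scale.
have nj : \forall u \near a, cod (atlas j) u.
  by apply: open_nbhs_nbhs; split; [exact: open_cod|].
have /near_normP[r1 r10 jr] := nj.
pose e := Num.min r r1.
have e0 : 0 < e by rewrite lt_min r0.
have er u : `|u - a| < e -> `|u - a| < r by rewrite lt_min => /andP[].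
have ej u : `|u - a| < e -> cod (atlas j) u by rewrite lt_min => /andP[_ /jr].
have X0 u : `|u - a| < e -> u != a -> X (of_coord (atlas j) u) != 0.
  move=> /er ur ua; apply: contraNneq (Xr u ur ua) => X0.
  by apply/eqP; exact: field_in0.
have f1 u : `|u - a| < e -> u != a -> C1_at (f \o of_coord (atlas j)) u.
  move=> ue ua; exact: (factor_C1_regular X1 Y1 YfX (ej u ue) (X0 u ue ua)).
apply: (hyperbolic_C1_extension e0 Xa hyp _ fa f1).
  by move=> u /ej; exact: C1_field_at.
move=> u ue ua; have df := nbhs_singleton (f1 u ue ua).1.
apply: (etrans (diff_along_field X (ej u ue) df)).
exact: (factor_invariant_regular X1 Y1 YfX (br _) (X0 u ue ua)).
Unshelve. all: by end_near. Qed.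

End QuasiTrivial.

Theorem theoremA (R : realType) (d : nat) (hd : (2 <= d)%N)
    (M : smooth_manifold R d) (Mcompact : compact [set: M])
    (X : vector_field M) (XC1 : C1_field X)
    (Xcollinear : collinear_C1_centralizer X)
    (Xhyperbolic : forall s : M, singularity X s -> hyperbolic X s) :
  quasi_trivial_C1_centralizer X.
Proof.
move=> Y XY; have [YC1 br] := XY.
have zer x : X x = 0 -> Y x = 0.
  by move=> X0; exact: centralizer_singularity (Xhyperbolic x X0) (br x).
have fac x : X x != 0 -> exists c : R, Y x = c *: X x.
  by move=> X0; exact: collinear_factor X0 (Xcollinear Y XY x).
have [f [YfX JYX]] := centralizer_factor (Ordinal hd) XC1 YC1 Xhyperbolic fac zer.
have fsing s : X s = 0 -> C1_at (f \o of_coord (chart_near s)) (coord_at s).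
  move=> X0; exact: (factor_C1_singular XC1 YC1 YfX br X0 (Xhyperbolic s X0) (JYX s X0)).
exists f; split=> //.
  move=> i; apply: C1_at_Ck1 => u iu.
  have [X0|X0] := eqVneq (X (of_coord (atlas i) u)) 0; last first.
    exact: (factor_C1_regular XC1 YC1 YfX iu X0).
  have ju := chart_at_dom (of_coord (atlas i) u).
  apply: (C1_at_transition iu ju); exact: fsing.
move=> x; have [X0|X0] := eqVneq (X x) 0.
  by rewrite /lie_derivative X0 linear0.
exact: (factor_invariant_regular XC1 YC1 YfX (br x) X0).
Qed.
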